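(* Let $X$ and $Y$ be operator spaces that are strongly TRO equivalent by TRO's $M_1$ and $M_2$, i.e. $X=[M_2YM_1^*]^{-\|\cdot\|}$ and $Y=[M_2^*XM_1]^{-\|\cdot\|}$. Suppose there exist sequences $(m_i)_{i\in\mathbb{N}},(n_i)_{i\in\mathbb{N}}\subseteq M_2$ such that $\sum_{i=1}^k m_im_i^*$ and $\sum_{i=1}^k n_i^*n_i$ are contractions for all $k$ and $$\lim_k\sum_{i=1}^k m_im_i^*x=x\ \text{ for all }x\in X,\qquad \lim_k\sum_{i=1}^k n_i^*n_iy=y\ \text{ for all }y\in Y,$$ and sequences $(e_i)_{i\in\mathbb{N}},(f_i)_{i\in\mathbb{N}}\subseteq M_1$ such that $\sum_{i=1}^k e_ie_i^*$ and $\sum_{i=1}^k f_i^*f_i$ are contractions for all $k$ and $$\lim_k x\sum_{i=1}^k e_ie_i^*=x\ \text{ for all }x\in X,\qquad \lim_k y\sum_{i=1}^k f_i^*f_i=y\ \text{ for all }y\in Y.$$ Then $X$ and $Y$ are stably isomorphic.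
   Context: An operator space is a norm closed subspace of $\mathcal{B}(K_1,K_2)$ ($K_1,K_2$ Hilbert spaces). $[S]^{-\|\cdot\|}$ denotes the norm closed linear span of $S$. All limits are in norm. A TRO is an operator space $M$ with $MM^*M\subseteq M$. $X\subseteq \mathcal{B}(K_1,K_2)$ and $Y\subseteq \mathcal{B}(H_1,H_2)$ are strongly TRO equivalent by $M_1,M_2$ if $M_1\subseteq \mathcal{B}(H_1,K_1)$ and $M_2\subseteq\mathcal{B}(H_2,K_2)$ are TRO's satisfying the identities in the claim. For an operator space $X\subseteq\mathcal{B}(K_1,K_2)$, $\mathcal{K}_\infty(X)\subseteq \mathcal{B}(K_1^{(\infty)},K_2^{(\infty)})$ is the norm closure of the finitely supported infinite matrices with entries in $X$. Operator spaces $X$ and $Y$ are stably isomorphic if $\mathcal{K}_\infty(X)$ and $\mathcal{K}_\infty(Y)$ are completely isometrically isomorphic. *)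

(* Defs.v *)
From HB Require Import structures.
From mathcomp Require Import all_boot all_order all_algebra.
From mathcomp Require Import sesquilinear complex.
From mathcomp Require Import all_classical all_reals all_analysis.
From mathcomp Require Import ring lra.

Set Implicit Arguments.
Unset Strict Implicit.
Unset Printing Implicit Defensive.

Import Order.TTheory GRing.Theory Num.Theory Num.Def.
Import numFieldTopology.Exports numFieldNormedType.Exports.

Local Open Scope classical_set_scope.
Local Open Scope complex_scope.
Local Open Scope ring_scope.

Section DotNorm.
Variables (C : numClosedFieldType) (U : lmodType C) (form : {dot U for @conjC C}).
Local Notation "''[' u , v ]" := (form u v) : ring_scope.
Local Notation "''[' u ]" := (form u u) : ring_scope.

Lemma dot_CauchySchwarz (u v : U) : `|'[u, v]| ^+ 2 <= '[u] * '[v].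
Proof.
have [-> | nz_v] := eqVneq v 0; first by rewrite !linear0 normr0 expr0n mulr0.
without loss ou : u / '[u, v] = 0.
  move=> IHo; pose a := '[u, v] / '[v]; pose u1 := u - a *: v.
  have ou : '[u1, v] = 0.
    by rewrite linearBl/= linearZl_LR divfK ?dnorm_eq0 ?subrr.
  rewrite (canRL (subrK _) (erefl u1)).
  rewrite linearDl /= ou add0r.
  rewrite linearZl_LR/= normrM (ger0_norm (dnorm_ge0 _ _)).
  rewrite exprMn hnormDd/=; last by rewrite linearZr_LR/= ou mulr0.
  rewrite dnormZ mulrDl expr2 mulrA lerDr mulr_ge0 ?dnorm_ge0//.
by rewrite ou normr0 expr0n mulr_ge0 ?dnorm_ge0.
Qed.

Lemma sqrtC_dotD (u v : U) :
  sqrtC '[u + v] <= sqrtC '[u] + sqrtC '[v].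
Proof.
rewrite -ler_sqr ?nnegrE ?addr_ge0 ?sqrtC_ge0 ?dnorm_ge0//.
rewrite sqrrD !sqrtCK addrAC dnormD lerD2l.
have := dot_CauchySchwarz u v.
rewrite -{1}(sqrtCK '[u]) -{1}(sqrtCK '[v]) -exprMn ler_sqr; last 2 first.
- by rewrite nnegrE.
- by rewrite nnegrE mulr_ge0 ?sqrtC_ge0 ?dnorm_ge0.
move=> CS; rewrite -mulr_natr -[leLHS](@divfK _ 2)// ler_pM2r ?ltr0n//.
rewrite -ReE.
exact: le_trans (leif_Re_Creal _) CS.
Qed.

Lemma sqrtC_dotZ (a : C) (u : U) : sqrtC '[a *: u] = `|a| * sqrtC '[u].
Proof.
by rewrite dnormZ sqrtCM ?nnegrE ?exprn_ge0 ?dnorm_ge0// sqrCK.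
Qed.

Lemma sqrtC_dot_eq0 (u : U) : sqrtC '[u] = 0 -> u = 0.
Proof. by move/eqP; rewrite sqrtC_eq0 dnorm_eq0 => /eqP. Qed.

End DotNorm.

(* A complex Hilbert space: a Banach space over R[i] whose norm comes from an
   inner product, linear in its first argument and conjugate-linear in the
   second. *)
HB.mixin Record CompleteNormedModule_isHilbert (R : realType) H
    & CompleteNormedModule R[i] H := {
  hdot : {dot H for (@conjC R[i])} ;
  hdotE : forall x : H, hdot x x = `|x| ^+ 2
}.

#[short(type="hilbertType")]
HB.structure Definition Hilbert (R : realType) :=
  { H of CompleteNormedModule R[i] H & CompleteNormedModule_isHilbert R H }.

(* Norms of normed modules over R[i] take their values in R[i]; [nrm] is the
   same norm read in R (see [nrmE]), where suprema are available. *)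
Section RealNorm.
Variable R : realType.

Definition nrm (V : normedModType R[i]) (x : V) : R := complex.Re `|x|.

Section NormedModule.
Variable V : normedModType R[i].
Implicit Types x y : V.

Lemma nrmE x : `|x| = (nrm x)%:C.
Proof. by rewrite /nrm RRe_real ?normr_real. Qed.

Lemma nrm_ge0 x : 0 <= nrm x.
Proof. by rewrite -ler0c -nrmE. Qed.

Lemma nrm0 : nrm (0 : V) = 0.
Proof. by apply: complexI; rewrite -nrmE normr0. Qed.

Lemma nrm0_eq0 x : nrm x = 0 -> x = 0.
Proof. by move=> x0; apply/normr0_eq0; rewrite nrmE x0. Qed.

Lemma nrmN x : nrm (- x) = nrm x.
Proof. by rewrite /nrm normrN. Qed.

Lemma nrmD x y : nrm (x + y) <= nrm x + nrm y.
Proof. by rewrite -lecR rmorphD/= -!nrmE ler_normD. Qed.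

Lemma nrmZ (a : R[i]) x : nrm (a *: x) = complex.Re `|a| * nrm x.
Proof.
apply: complexI.
by rewrite rmorphM/= -!nrmE normrZ; congr (_ * _); rewrite RRe_real ?normr_real.
Qed.

End NormedModule.

Section Dot.
Variable H : hilbertType R.
Implicit Types x y : H.

Lemma nrm_sqr x : nrm x ^+ 2 = complex.Re (hdot x x).
Proof. by rewrite hdotE nrmE -rmorphXn. Qed.

Lemma hdotC x y : hdot y x = (hdot x y)^*%C.
Proof. by rewrite (hermC (@hdot R H)) expr0 mul1r. Qed.

End Dot.
End RealNorm.

(* [bop H K] is B(H, K); its norm is the operator norm, see [normr_bop]. *)
Section Bop.
Variables (R : realType) (H K : hilbertType R).

Definition is_bop : {pred H -> K} := fun f => `[< linear f /\ continuous f >].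

Lemma is_bopP (f : H -> K) : reflect (linear f /\ continuous f) (f \in is_bop).
Proof. by rewrite unfold_in; exact: asboolP. Qed.

Record bop := Bop { bop_fun :> H -> K ; bop_subproof : bop_fun \in is_bop }.

HB.instance Definition _ := [isSub for bop_fun].
HB.instance Definition _ := [Choice of bop by <:].

Lemma is_bop_submod_closed : submod_closed is_bop.
Proof.
split=> [|a f g].
- by apply/is_bopP; split; [move=> a x y; rewrite scaler0 addr0|exact: cst_continuous].
- move=> /is_bopP[lf cf] /is_bopP[lg cg]; apply/is_bopP; split.
  + move=> b x y; rewrite !fctE.
    rewrite /= lf lg !scalerDr !scalerA (mulrC a b) -!addrA; congr (_ + _).
    by rewrite addrCA.
  + move=> x; apply: continuousD; last exact: cg.
    exact: (@continuousZl_tmp _ _ _ f a x (cf x)).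
Qed.

HB.instance Definition _ :=
  GRing.isSubmodClosed.Build R[i] (H -> K) is_bop is_bop_submod_closed.
HB.instance Definition _ := [SubChoice_isSubLmodule of bop by <:].

Lemma bop_linear (T : bop) : linear T.
Proof. by have /is_bopP[] := bop_subproof T. Qed.

Lemma bop_continuous (T : bop) : continuous T.
Proof. by have /is_bopP[] := bop_subproof T. Qed.

HB.instance Definition _ (T : bop) :=
  GRing.isLinear.Build R[i] H K *:%R T (@bop_linear T).

Lemma bopE0 x : (0 : bop) x = 0. Proof. by []. Qed.
Lemma bopED (S T : bop) x : (S + T) x = S x + T x. Proof. by []. Qed.
Lemma bopEZ a (T : bop) x : (a *: T) x = a *: T x. Proof. by []. Qed.

Lemma eq_bop (S T : bop) : S =1 T -> S = T.
Proof. by move=> ST; apply/val_inj/funext. Qed.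

End Bop.

Section OpNorm.
Variables (R : realType) (H K : hilbertType R).
Implicit Types (S T : bop H K) (M : R).

Lemma bop_bounded T : exists2 M, 0 < M & forall x, nrm (T x) <= M * nrm x.
Proof.
have /(linear_bounded_continuous (T : {linear H -> K})) := @bop_continuous _ _ _ T.
move=> /linear_boundedP/pinfty_ex_gt0[M M0 TM].
have MR : M = (complex.Re M)%:C by rewrite RRe_real ?gtr0_real.
exists (complex.Re M); [by rewrite -ltcR -MR|].
by move=> x; rewrite -lecR rmorphM/= -MR -!nrmE; exact: TM.
Qed.

Definition opnorm T : R := sup [set nrm (T x) | x in [set x : H | nrm x <= 1]].

Lemma opnorm_has_sup T :
  has_sup [set nrm (T x) | x in [set x : H | nrm x <= 1]].
Proof.
split; first by exists (nrm (T 0)), 0 => //=; rewrite nrm0.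
have [M M0 TM] := bop_bounded T; exists M => _ [x /= x1 <-].
by rewrite (le_trans (TM x))// -[leRHS]mulr1 ler_wpM2l// ltW.
Qed.

Lemma opnormP T x : nrm (T x) <= opnorm T * nrm x.
Proof.
have [->|x0] := eqVneq x 0; first by rewrite linear0 !nrm0 mulr0.
have nx0 : 0 < nrm x.
  rewrite lt_neqAle nrm_ge0 andbT eq_sym.
  by apply: contra_neq x0 => /nrm0_eq0.
have re_inv : complex.Re `|(nrm x)^-1%:C| = (nrm x)^-1.
  by rewrite normc_def/= expr0n addr0 sqrtr_sqr gtr0_norm ?invr_gt0.
rewrite -ler_pdivrMr// mulrC -[X in X * _]re_inv -nrmZ -linearZ.
apply: sup_upper_bound; first exact: opnorm_has_sup.
by exists ((nrm x)^-1%:C *: x) => //=; rewrite nrmZ re_inv mulVf ?gt_eqF.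
Qed.

Lemma opnorm_ge0 T : 0 <= opnorm T.
Proof.
apply: le_trans (nrm_ge0 (T 0)) _.
apply: sup_upper_bound; first exact: opnorm_has_sup.
by exists 0 => //=; rewrite nrm0.
Qed.

Lemma opnorm_le M T : 0 <= M -> (forall x, nrm (T x) <= M * nrm x) -> opnorm T <= M.
Proof.
move=> M0 TM; apply: ge_sup; first by have [] := opnorm_has_sup T.
by move=> _ [x /= x1 <-]; rewrite (le_trans (TM x))// -[leRHS]mulr1 ler_wpM2l.
Qed.

Lemma opnormD S T : (opnorm (S + T))%:C <= (opnorm S)%:C + (opnorm T)%:C.
Proof.
rewrite -rmorphD lecR; apply: opnorm_le; first by rewrite addr_ge0 ?opnorm_ge0.
by move=> x; rewrite bopED mulrDl (le_trans (nrmD _ _))// lerD ?opnormP.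
Qed.

Lemma opnormZ_le a T : opnorm (a *: T) <= complex.Re `|a| * opnorm T.
Proof.
have a0 : 0 <= complex.Re `|a|.
  by rewrite -ler0c RRe_real ?normr_real ?normr_ge0.
apply: opnorm_le; first by rewrite mulr_ge0 ?opnorm_ge0.
by move=> x; rewrite bopEZ nrmZ -mulrA ler_wpM2l// opnormP.
Qed.

Lemma opnormZ a T : (opnorm (a *: T))%:C = `|a| * (opnorm T)%:C.
Proof.
have [->|a0] := eqVneq a 0.
  rewrite normr0 mul0r scale0r; congr (_%:C).
  apply/eqP; rewrite eq_le opnorm_ge0 andbT.
  by apply: opnorm_le => // x; rewrite bopE0 nrm0 mul0r.
rewrite -[`|a|]RRe_real ?normr_real// -rmorphM; congr (_%:C).
apply/eqP; rewrite eq_le opnormZ_le/=.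
have a_gt0 : 0 < complex.Re `|a| by rewrite -ltcR RRe_real ?normr_real//; rewrite normr_gt0.
rewrite mulrC -ler_pdivlMr// mulrC.
have -> : (complex.Re `|a|)^-1 = complex.Re `|a^-1|.
  have reN (b : R[i]) : (complex.Re `|b|)%:C = `|b| by rewrite RRe_real ?normr_real.
  by apply: complexI; rewrite fmorphV; rewrite !reN normfV.
by rewrite -{1}[T]scale1r -(mulVf a0) -scalerA opnormZ_le.
Qed.

Lemma opnorm_eq0 T : (opnorm T)%:C = 0 -> T = 0.
Proof.
move=> /complexI T0; apply: eq_bop => x; apply: nrm0_eq0; apply/eqP.
by rewrite eq_le nrm_ge0 andbT (le_trans (opnormP T x))// T0 mul0r.
Qed.

HB.instance Definition _ := @Lmodule_isNormed.Build R[i] (bop H K)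
  (fun T => (opnorm T)%:C) opnormD opnormZ opnorm_eq0.

Lemma normr_bop T : `|T| = (opnorm T)%:C. Proof. by []. Qed.

Lemma mkbop_subproof (f : H -> K) : linear f ->
  (exists M, forall x, nrm (f x) <= M * nrm x) -> f \in @is_bop R H K.
Proof.
move=> lf [M fM]; apply/is_bopP; split => //.
pose g : {linear H -> K} := HB.pack f (GRing.isLinear.Build _ _ _ _ _ lf).
apply: (@bounded_linear_continuous _ _ _ g).
apply/linear_boundedP.
have MR : M%:C \is Num.real by rewrite complex_real.
apply: filterS (nbhs_pinfty_ge MR) => r Mr x.
rewrite (@le_trans _ _ (M%:C * `|x|))//; last by rewrite ler_wpM2r.
by rewrite !nrmE -rmorphM lecR.
Qed.

Definition mkbop (f : H -> K) (lf : linear f)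
  (bf : exists M, forall x, nrm (f x) <= M * nrm x) : bop H K :=
  Bop (mkbop_subproof lf bf).

End OpNorm.

Section Comp.
Variables (R : realType) (H K L : hilbertType R).

Lemma bcomp_subproof (S : bop K L) (T : bop H K) : S \o T \in @is_bop R H L.
Proof.
apply/is_bopP; split; first by move=> a x y /=; rewrite !linearP.
by move=> x; apply: continuous_comp; exact: bop_continuous.
Qed.

Definition bcomp (S : bop K L) (T : bop H K) : bop H L := Bop (bcomp_subproof S T).

End Comp.

Section Polarization.
Variables (R : realType) (H : hilbertType R).
Implicit Types x y : H.

Lemma Re_hdot x y :
  complex.Re (hdot x y) = (nrm (x + y) ^+ 2 - nrm x ^+ 2 - nrm y ^+ 2) / 2.
Proof.
rewrite !nrm_sqr dnormD; set d := hdot x y.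
rewrite !raddfD/= -[d^*]/(d^*%C) -addrA -opprD addrC addKr.
case: d => a b /=. lra.
Qed.

Lemma Im_hdot x y : complex.Im (hdot x y) = complex.Re (hdot x ('i%C *: y)).
Proof.
rewrite (linearZr_LR (@hdot R H))/= -[('i%C)^*]/(('i%C)^*%C).
by case: (hdot x y) => a b /=; rewrite mul0r sub0r mulN1r opprK.
Qed.

Lemma nrm_sqrD x y : nrm (x + y) ^+ 2 <= 2 * nrm x ^+ 2 + 2 * nrm y ^+ 2.
Proof.
apply: (@le_trans _ _ ((nrm x + nrm y) ^+ 2)).
  by rewrite ler_sqr ?nnegrE ?addr_ge0 ?nrm_ge0// nrmD.
have := sqr_ge0 (nrm x - nrm y); rewrite sqrrB sqrrD; move: (_ ^+ 2) (_ ^+ 2) (_ * _).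
by move=> a b c; rewrite !mulr2n !mulrDl !mul1r; lra.
Qed.

End Polarization.

(* [l2 K] is the Hilbert space sum of countably many copies of K. *)
Section L2.
Variables (R : realType) (K : hilbertType R).

Definition is_l2 : {pred nat -> K} :=
  fun f => `[< cvgn (series (fun i => nrm (f i) ^+ 2)) >].

Lemma is_l2P (f : nat -> K) :
  reflect (cvgn (series (fun i => nrm (f i) ^+ 2))) (f \in is_l2).
Proof. by rewrite unfold_in; exact: asboolP. Qed.

Lemma is_l2_bounded (f : nat -> K) :
  (exists M : R, forall n, \sum_(0 <= i < n) nrm (f i) ^+ 2 <= M) -> f \in is_l2.
Proof.
move=> [M fM]; apply/is_l2P; apply: nondecreasing_is_cvgn.
  by apply: nondecreasing_series => n _ _; exact: sqr_ge0.
by exists M => _ [n _ <-]; exact: fM.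
Qed.

Lemma l2_partial_le (f : nat -> K) n : f \in is_l2 ->
  \sum_(0 <= i < n) nrm (f i) ^+ 2 <= limn (series (fun i => nrm (f i) ^+ 2)).
Proof.
move=> /is_l2P cf; apply: (nondecreasing_cvgn_le _ cf).
by apply: nondecreasing_series => k _ _; exact: sqr_ge0.
Qed.

Lemma is_l2_submod_closed : submod_closed is_l2.
Proof.
split=> [|a f g fl gl]; apply: is_l2_bounded.
  by exists 0 => n; rewrite big1// => i _; rewrite nrm0 expr0n.
set A := limn (series (fun i => nrm (f i) ^+ 2)).
set B := limn (series (fun i => nrm (g i) ^+ 2)).
exists (2 * (complex.Re `|a| ^+ 2 * A) + 2 * B) => n.
apply: (@le_trans _ _ (\sum_(0 <= i < n)
    (2 * (complex.Re `|a| ^+ 2 * nrm (f i) ^+ 2) + 2 * nrm (g i) ^+ 2))).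
  by apply: ler_sum => i _; rewrite -exprMn -nrmZ nrm_sqrD.
rewrite big_split/= -!big_distrr/= lerD// ler_wpM2l//; last exact: l2_partial_le.
by rewrite ler_wpM2l ?sqr_ge0//; exact: l2_partial_le.
Qed.

Record l2 := L2 { l2_fun :> nat -> K ; l2_subproof : l2_fun \in is_l2 }.

HB.instance Definition _ := [isSub for l2_fun].
HB.instance Definition _ := [Choice of l2 by <:].
HB.instance Definition _ :=
  GRing.isSubmodClosed.Build R[i] (nat -> K) is_l2 is_l2_submod_closed.
HB.instance Definition _ := [SubChoice_isSubLmodule of l2 by <:].

Implicit Types f g h : l2.

Lemma l2E0 i : (0 : l2) i = 0. Proof. by []. Qed.
Lemma l2ED f g i : (f + g) i = f i + g i. Proof. by []. Qed.
Lemma l2EN f i : (- f) i = - f i. Proof. by []. Qed.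
Lemma l2EB f g i : (f - g) i = f i - g i. Proof. by []. Qed.
Lemma l2EZ a f i : (a *: f) i = a *: f i. Proof. by []. Qed.
Lemma eq_l2 f g : f =1 g -> f = g.
Proof. by move=> fg; apply/val_inj/funext. Qed.

Lemma is_cvg_l2 f : cvgn (series (fun i => nrm (f i) ^+ 2)).
Proof. exact/is_l2P/l2_subproof. Qed.

Lemma is_cvg_Re_dot f g : cvgn (series (fun i => complex.Re (hdot (f i) (g i)))).
Proof.
have -> : (fun i => complex.Re (hdot (f i) (g i))) =
    2^-1 *: ((fun i => nrm ((f + g) i) ^+ 2) - (fun i => nrm (f i) ^+ 2)
     - (fun i => nrm (g i) ^+ 2)).
  by apply/funext => i; rewrite Re_hdot mulrC.
apply: is_cvg_seriesZ; apply: is_cvg_seriesB; last exact: is_cvg_l2.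
by apply: is_cvg_seriesB; exact: is_cvg_l2.
Qed.

Lemma is_cvg_Im_dot f g : cvgn (series (fun i => complex.Im (hdot (f i) (g i)))).
Proof.
have -> : (fun i => complex.Im (hdot (f i) (g i))) =
    (fun i => complex.Re (hdot (f i) (('i%C *: g) i))).
  by apply/funext => i; rewrite Im_hdot.
exact: is_cvg_Re_dot.
Qed.

Definition l2_dot f g : R[i] :=
  limn (series (fun i => complex.Re (hdot (f i) (g i)))) +i*
  limn (series (fun i => complex.Im (hdot (f i) (g i)))).

Lemma lim_series_lin (p q : R) (u v w : R^nat) :
  cvgn (series u) -> cvgn (series v) -> cvgn (series w) ->
  limn (series (fun i => p * u i + q * v i + w i)) =
  p * limn (series u) + q * limn (series v) + limn (series w).
Proof.
move=> cu cv cw.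
have -> : (fun i => p * u i + q * v i + w i) = p *: u + q *: v + w by [].
have cpu : cvgn (series (p *: u)) by exact: is_cvg_seriesZ.
have cqv : cvgn (series (q *: v)) by exact: is_cvg_seriesZ.
rewrite lim_seriesD//; last exact: is_cvg_seriesD.
by rewrite lim_seriesD// !lim_seriesZ.
Qed.

Lemma l2_hdotPl g a f h i :
  hdot ((a *: f + h) i) (g i) = a * hdot (f i) (g i) + hdot (h i) (g i).
Proof. by rewrite l2ED l2EZ linearDl linearZl_LR. Qed.

Lemma l2_dotPl g a f h : l2_dot (a *: f + h) g = a * l2_dot f g + l2_dot h g.
Proof.
have cRe := is_cvg_Re_dot; have cIm := is_cvg_Im_dot.
case: a => p q; rewrite /l2_dot; apply/eqP; rewrite eq_complex/=.
rewrite -mulNr -!lim_series_lin//; apply/andP; split; apply/eqP.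
- congr (limn (series _)); apply/funext => i.
  rewrite [LHS](congr1 (@complex.Re R) (l2_hdotPl g (p +i* q) f h i)).
  by case: (hdot (f i) _) => x y; case: (hdot (h i) _) => z t /=; rewrite mulNr.
- congr (limn (series _)); apply/funext => i.
  rewrite [LHS](congr1 (@complex.Im R) (l2_hdotPl g (p +i* q) f h i)).
  by case: (hdot (f i) _) => x y; case: (hdot (h i) _) => z t /=.
Qed.

Lemma l2_dotC f g : l2_dot f g = (l2_dot g f)^*%C.
Proof.
rewrite /l2_dot; apply/eqP; rewrite eq_complex/=.
apply/andP; split; apply/eqP.
  congr (limn (series _)); apply/funext => i.
  by rewrite hdotC; case: (hdot _ _).
rewrite -lim_seriesN; last exact: is_cvg_Im_dot.
congr (limn (series _)); apply/funext => i.
by rewrite hdotC; rewrite [RHS]/GRing.opp/=; case: (hdot _ _).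
Qed.

Lemma l2_dot_bilinear :
  bilinear_for *%R ((@conjC R[i]) \; *%R) l2_dot.
Proof.
split=> [g a f h|f a g h] /=; first exact: l2_dotPl.
rewrite l2_dotC l2_dotPl (l2_dotC f g) (l2_dotC f h).
by rewrite (rmorphD (@conjc R)) (rmorphM (@conjc R)).
Qed.

HB.instance Definition _ := bilinear_isBilinear.Build R[i] l2 l2 R[i]
  (GRing.Scale.Law.clone _ _ ( *%R ) _)
  (GRing.Scale.Law.clone _ _ ((@conjC R[i]) \; *%R ) _)
  l2_dot l2_dot_bilinear.

Lemma l2_dot_hermitian f g :
  l2_dot f g = (-1) ^+ false * (@conjC R[i]) (l2_dot g f).
Proof. by rewrite expr0 mul1r l2_dotC. Qed.

HB.instance Definition _ :=
  @isHermitianSesquilinear.Build _ _ _ _ l2_dot l2_dot_hermitian.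

Lemma l2_dotE f : l2_dot f f = (limn (series (fun i => nrm (f i) ^+ 2)))%:C.
Proof.
rewrite /l2_dot; apply/eqP; rewrite eq_complex/=; apply/andP; split; apply/eqP.
  by congr (limn (series _)); apply/funext => i; rewrite nrm_sqr.
rewrite (_ : (fun _ => _) = fun=> 0).
  rewrite (_ : series _ = fun=> 0) ?lim_cst//.
  by apply/funext => n; rewrite /series/= big1.
by apply/funext => i; rewrite hdotE nrmE -rmorphXn.
Qed.

Lemma l2_dot_gt0 f : f != 0 -> 0 < l2_dot f f.
Proof.
move=> f0; rewrite l2_dotE ltcR lt_neqAle; apply/andP; split; last first.
  have := l2_partial_le 0 (l2_subproof f); rewrite big_geq//.
apply: contra_neq f0 => lim0; apply: eq_l2 => i; rewrite l2E0.
apply: nrm0_eq0; apply/eqP; rewrite -sqrf_eq0 eq_le sqr_ge0 andbT.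
rewrite [leRHS]lim0; apply: le_trans (l2_partial_le i.+1 (l2_subproof f)).
by rewrite big_nat_recr//= lerDr sumr_ge0// => j _; exact: sqr_ge0.
Qed.

HB.instance Definition _ := @isDotProduct.Build _ _ l2_dot l2_dot_gt0.

HB.instance Definition _ := @Lmodule_isNormed.Build R[i] l2
  (fun f => sqrtC (l2_dot f f))
  (sqrtC_dotD (l2_dot : {dot l2 for @conjC R[i]}))
  (sqrtC_dotZ (l2_dot : {dot l2 for @conjC R[i]}))
  (sqrtC_dot_eq0 (form := l2_dot : {dot l2 for @conjC R[i]})).

Lemma l2_dot_norm f : l2_dot f f = `|f| ^+ 2.
Proof. by rewrite sqrtCK. Qed.

Lemma nrm_l2 f : nrm f ^+ 2 = limn (series (fun i => nrm (f i) ^+ 2)).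
Proof. by apply: complexI; rewrite rmorphXn -[RHS]l2_dotE l2_dot_norm nrmE. Qed.

Lemma nrm_l2_partial f n : \sum_(0 <= i < n) nrm (f i) ^+ 2 <= nrm f ^+ 2.
Proof. by rewrite nrm_l2 l2_partial_le ?l2_subproof. Qed.

Lemma nrm_l2_le f (M : R) :
  (forall n, \sum_(0 <= i < n) nrm (f i) ^+ 2 <= M) -> nrm f ^+ 2 <= M.
Proof.
move=> fM; rewrite nrm_l2; apply: limr_le; first exact: is_cvg_l2.
by apply: nearW => n; exact: fM.
Qed.

Lemma nrm_l2_coord f i : nrm (f i) <= nrm f.
Proof.
rewrite -ler_sqr ?nnegrE ?nrm_ge0//; apply: le_trans (nrm_l2_partial f i.+1).
by rewrite big_nat_recr//= lerDr sumr_ge0// => j _; exact: sqr_ge0.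
Qed.

End L2.

Section NrmCvg.
Variables (R : realType) (V : normedModType R[i]).

Lemma nrm_lt (x : V) (e : R) : (`|x| < e%:C) = (nrm x < e).
Proof. by rewrite nrmE ltcR. Qed.

Lemma cvg_nrmP (T : Type) (F : set_system T) (FF : Filter F) (u : T -> V) (l : V) :
  u @ F --> l <-> forall e : R, 0 < e -> \forall t \near F, nrm (l - u t) < e.
Proof.
split => [/cvgrPdist_lt ul e e0|ul].
  have e0C : 0 < e%:C :> R[i] by rewrite ltcR.
  by apply: filterS (ul _ e0C) => t; rewrite nrm_lt.
apply/cvgrPdist_lt => e e0.
have eR : e = (complex.Re e)%:C by rewrite RRe_real ?gtr0_real.
rewrite eR; have {}e0 : 0 < complex.Re e by rewrite -ltcR -eR.
by apply: filterS (ul _ e0) => t; rewrite nrm_lt.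
Qed.

Lemma cvg_nrm (T : Type) (F : set_system T) (FF : Filter F) (u : T -> V) (l : V) :
  u @ F --> l -> nrm (u t) @[t --> F] --> nrm l.
Proof.
move=> /cvg_nrmP ul; apply/cvgrPdist_lt => e e0.
apply: filterS (ul e e0) => t; apply: le_lt_trans.
rewrite ler_norml; apply/andP; split.
  by rewrite lerNl opprB lerBlDr -(nrmN (l - u t)) opprB -{1}(subrK l (u t)) nrmD.
by rewrite lerBlDr -{1}(subrK (u t) l) nrmD.
Qed.

End NrmCvg.

Lemma cvg_sum_nat (R : realType) (T : Type) (F : set_system T) (FF : Filter F)
    (u : nat -> T -> R) (l : nat -> R) n : (forall i, u i @ F --> l i) ->
  \sum_(0 <= i < n) u i t @[t --> F] --> \sum_(0 <= i < n) l i.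
Proof.
move=> ul; elim: n => [|n IH].
  rewrite big_geq// (_ : (fun _ => _) = fun=> 0); first exact: cvg_cst.
  by apply/funext => t; rewrite big_geq.
rewrite big_nat_recr//= (_ : (fun _ => _) =
  (fun t => \sum_(0 <= i < n) u i t) + u n); first exact: cvgD.
by apply/funext => t; rewrite big_nat_recr.
Qed.

Section L2Complete.
Variables (R : realType) (K : hilbertType R).
Local Notation l2 := (l2 K).

Lemma l2_complete (F : set_system l2) : ProperFilter F -> cauchy F -> cvg F.
Proof.
move=> FF /cauchyP Fc.
have ballE (f g : l2) (e : R) : ball f e%:C g <-> nrm (f - g) < e.
  by rewrite -ball_normE /ball_/= nrm_lt.
have Fcoord i : cvg ((fun f : l2 => f i) @ F).
  apply: cauchy_cvg; apply: cauchy_exP => e /Fc[f Ff]; exists (f i).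
  change (F [set g : l2 | ball (f i) e (g i)]).
  apply: filterS Ff => g; rewrite -!ball_normE /ball_/=; apply: le_lt_trans.
  by rewrite -[f i - g i]/((f - g) i) !nrmE lecR nrm_l2_coord.
pose l i := lim ((fun f : l2 => f i) @ F).
have key (e : R) (f0 f : l2) : 0 < e -> F (ball f0 e%:C) -> ball f0 e%:C f ->
    forall n, \sum_(0 <= i < n) nrm (f i - l i) ^+ 2 <= (2 * e) ^+ 2.
  move=> e0 Ff0 f0f n.
  have cl : (fun g : l2 => \sum_(0 <= i < n) nrm (f i - g i) ^+ 2) @ F -->
      \sum_(0 <= i < n) nrm (f i - l i) ^+ 2.
    apply: cvg_sum_nat => i; apply: cvgM; apply: cvg_nrm; apply: cvgB => //;
    by [exact: cvg_cst|exact: Fcoord].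
  apply: (cvgr_to_le cl).
  apply: filterS Ff0 => g f0g.
  apply: (le_trans (nrm_l2_partial (f - g) n)).
  rewrite ler_sqr ?nnegrE ?nrm_ge0 ?mulr_ge0 ?(ltW e0)//.
  have -> : f - g = (f - f0) + (f0 - g) by rewrite subrKA.
  apply: (le_trans (nrmD _ _)).
  rewrite -(nrmN (f - f0)) opprB mulr_natl mulr2n.
  by apply: lerD; apply/ltW/ballE.
have L_l2 : l \in @is_l2 R K.
  have /Fc[f0 Ff0] : 0 < (1 : R)%:C :> R[i] by rewrite ltcR.
  have f0f0 : ball f0 (1 : R)%:C f0 by apply/ballE; rewrite subrr nrm0.
  have dl : (fun i => f0 i - l i) \in @is_l2 R K.
    by apply: is_l2_bounded; exists ((2 * 1) ^+ 2); exact: (key _ f0).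
  rewrite (_ : l = f0 - L2 dl); first exact: l2_subproof.
  by apply/funext => i /=; rewrite !fctE/= subKr.
apply/cvg_ex; exists (L2 L_l2).
apply/(cvg_nrmP _ (id : l2 -> l2)) => e e0.
have e4 : 0 < e / 4 by lra.
have /Fc[f0 Ff0] : 0 < (e / 4)%:C :> R[i] by rewrite ltcR.
apply: filterS (Ff0) => f f0f /=; rewrite -nrmN opprB.
apply: (@le_lt_trans _ _ (2 * (e / 4))); last lra.
rewrite -ler_sqr ?nnegrE ?nrm_ge0 ?mulr_ge0 ?(ltW e0) ?(ltW e4)//.
by apply: nrm_l2_le => n; exact: (key (e / 4) f0 f e4 Ff0 f0f n).
Qed.

HB.instance Definition _ := Uniform_isComplete.Build l2 l2_complete.

HB.instance Definition _ := CompleteNormedModule_isHilbert.Build R l2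
  (@l2_dot_norm R K : forall x : l2, (@l2_dot R K : {dot l2 for @conjC R[i]}) x x = `|x| ^+ 2).

End L2Complete.

Section Riesz.
Variables (R : realType) (H : hilbertType R).
Implicit Types x y z : H.

Lemma norm_Re_hdot x y : `|complex.Re (hdot x y)| <= nrm x * nrm y.
Proof.
rewrite -lecR; apply: le_trans (normc_ge_Re _) _.
rewrite -ler_sqr ?nnegrE// ?ler0c ?mulr_ge0 ?nrm_ge0//.
apply: le_trans (dot_CauchySchwarz _ _ _) _.
by rewrite !hdotE -exprMn !nrmE -rmorphM.
Qed.

Lemma hdot_inj y z : (forall x, hdot x y = hdot x z) -> y = z.
Proof.
move=> yz; apply/eqP; rewrite -subr_eq0 -(dnorm_eq0 (@hdot R H)).
by rewrite linearB/= yz subrr.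
Qed.

Lemma nrm_sqrDZ z x (t : R) : nrm (t%:C *: x + z) ^+ 2 =
  t ^+ 2 * nrm x ^+ 2 + 2 * t * complex.Re (hdot x z) + nrm z ^+ 2.
Proof.
have := Re_hdot (t%:C *: x) z.
rewrite (linearZl_LR (@hdot R H))/= nrmZ.
have -> : complex.Re (t%:C * hdot x z) = t * complex.Re (hdot x z).
  by case: (hdot x z) => a b /=; rewrite mul0r subr0.
have -> : complex.Re `|t%:C| = `|t|.
  by rewrite normc_def/= expr0n addr0 sqrtr_sqr.
rewrite exprMn real_normK ?num_real//; lra.
Qed.

Lemma riesz_Re (g : H -> R) (c : R) :
  (forall (a : R) x y, g (a%:C *: x + y) = a * g x + g y) ->
  (forall x, `|g x| <= c * nrm x) ->
  exists z, forall x, g x = complex.Re (hdot x z).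
Proof.
move=> glin gc.
pose J x := nrm x ^+ 2 - 2 * g x.
have Jge x : - c ^+ 2 <= J x.
  have := gc x; rewrite ler_norml => /andP[_ gx]; rewrite /J.
  by have := sqr_ge0 (nrm x - c); rewrite sqrrB mulr2n; nra.
have Jinf : has_inf (range J).
  by split; [exists (J 0), 0|exists (- c ^+ 2) => _ [x _ <-]].
pose m := inf (range J).
have mJ x : m <= J x by apply: ge_inf; [case: Jinf|exists x].
have para x y : nrm (x - y) ^+ 2 <= 2 * (J x - m) + 2 * (J y - m).
  have := mJ ((2^-1)%:C *: (x + y)); rewrite /J.
  have -> : (2^-1)%:C *: (x + y) = (2^-1)%:C *: x + (2^-1)%:C *: y.
    by rewrite scalerDr.
  have g0 : g 0 = 0 by have := glin 1 0 0; rewrite scaler0 addr0; lra.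
  have -> : g ((2^-1)%:C *: x + (2^-1)%:C *: y) = 2^-1 * g x + 2^-1 * g y.
    rewrite glin; congr (_ + _); rewrite -[(2^-1)%:C *: y]addr0 glin g0.
    by rewrite addr0.
  rewrite -scalerDr -[(2^-1)%:C *: (x + y)]addr0 nrm_sqrDZ nrm0 expr0n.
  rewrite (_ : hdot (x + y) 0 = 0) ?linear0//= !mulr0 !addr0.
  have -> : x - y = (-1)%:C *: y + x.
    by rewrite rmorphN1 scaleN1r addrC.
  rewrite nrm_sqrDZ.
  have -> : x + y = (1 : R)%:C *: y + x by rewrite scale1r addrC.
  rewrite nrm_sqrDZ; lra.
have [u Ju] : exists u : nat -> H, forall n, J (u n) < m + n.+1%:R^-1.
  have /choice[u Ju] : forall n : nat, exists x, J x < m + n.+1%:R^-1.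
    move=> n; have /(inf_adherent)/(_ Jinf)[_ [x _ <-] Jx] : 0 < n.+1%:R^-1 :> R.
      by rewrite invr_gt0.
    by exists x.
  by exists u.
have cu : cvg (u @ \oo).
  apply: cauchy_cvg; apply: cauchy_exP => e e0.
  have eR : e = (complex.Re e)%:C by rewrite RRe_real ?gtr0_real.
  have {}e0 : 0 < complex.Re e by rewrite -ltcR -eR.
  rewrite {}eR; move: (complex.Re e) e0 => {}e e0.
  have e24 : 0 < e ^+ 2 / 4 by rewrite divr_gt0// exprn_gt0.
  have [N _ NP] := near_infty_natSinv_lt (PosNum e24).
  exists (u N); exists N => // n /= Nn.
  rewrite -ball_normE /ball_/= nrm_lt -ltr_sqr ?nnegrE ?nrm_ge0 ?(ltW e0)//.
  apply: le_lt_trans (para _ _) _.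
  have small p : (N <= p)%N -> J (u p) - m < e ^+ 2 / 4.
    by move=> /NP/= pe; rewrite ltrBlDl; apply: lt_trans (Ju p) _; rewrite ltrD2l.
  move: (J (u N) - m) (J (u n) - m) (e ^+ 2) (small _ (leqnn N)) (small _ Nn).
  by move=> a b d; lra.
have [z uz] : exists z, u @ \oo --> z by exists (lim (u @ \oo)).
have Jz : J z <= m.
  have cg : g (u n) @[n --> \oo] --> g z.
    apply/cvgrPdist_lt => e e0.
    have c0 : 0 < `|c| + 1 by rewrite ltr_wpDl.
    have /cvg_nrmP/(_ (e / (`|c| + 1))) := uz.
    rewrite divr_gt0// => /(_ isT); apply: filterS => n.
    rewrite ltr_pdivlMr// mulrC; apply: le_lt_trans.
    have -> : g z - g (u n) = g (z - u n).
      have -> : z - u n = (-1)%:C *: u n + z by rewrite rmorphN1 scaleN1r addrC.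
      by rewrite glin mulN1r addrC.
    apply: le_trans (gc _) _; rewrite ler_wpM2r ?nrm_ge0//.
    by rewrite (le_trans (ler_norm _))// lerDl.
  have cJ : J (u n) @[n --> \oo] --> J z.
    apply: cvgB; first by apply: cvgM; exact: cvg_nrm.
    by apply: cvgM; [exact: cvg_cst|exact: cg].
  have cm : m + n.+1%:R^-1 @[n --> \oo] --> m.
    rewrite -[X in _ --> X]addr0; apply: cvgD; first exact: cvg_cst.
    exact: cvg_harmonic.
  rewrite -(cvg_lim _ cJ)// -(cvg_lim _ cm)//.
  apply: ler_lim; [by apply/cvg_ex; exists (J z)|by apply/cvg_ex; exists m|].
  by apply: nearW => n; exact/ltW/Ju.
exists z => x.
have var t : 0 <= t ^+ 2 * nrm x ^+ 2 + 2 * t * (complex.Re (hdot x z) - g x).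
  have := le_trans Jz (mJ (t%:C *: x + z)).
  by rewrite /J nrm_sqrDZ glin; lra.
set a := nrm x ^+ 2 in var; set b := complex.Re (hdot x z) - g x in var.
have a0 : 0 <= a by exact: sqr_ge0.
suff : b = 0 by rewrite /b; lra.
have := var (- b / (a + 1)).
have -> : (- b / (a + 1)) ^+ 2 * a + 2 * (- b / (a + 1)) * b =
  - (b ^+ 2 * (a + 2) / (a + 1) ^+ 2) by field; lra.
rewrite oppr_ge0 => b2; apply/eqP; rewrite -sqrf_eq0 eq_le sqr_ge0 andbT.
have a1 : 0 < a + 1 by lra.
have a2 : 0 < a + 2 by lra.
by move: b2; rewrite ler_pdivrMr ?exprn_gt0// mul0r pmulr_lle0.
Qed.

End Riesz.

Section Adjoint.
Variables (R : realType) (H K : hilbertType R).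
Implicit Types T : bop H K.

Lemma adj_exists T :
  exists S : bop K H, forall x y, hdot (T x) y = hdot x (S y).
Proof.
have /choice[s sP] y : exists z, forall x, hdot (T x) y = hdot x z.
  have [|x|z zP] := @riesz_Re R H (fun x => complex.Re (hdot (T x) y))
      (opnorm T * nrm y).
  - move=> a x x'; rewrite linearP/= linearDl (linearZl_LR (@hdot R K))/=.
    by rewrite raddfD/=; case: (hdot (T x) y) => p q /=; rewrite mul0r subr0.
  - apply: le_trans (norm_Re_hdot _ _) _.
    by rewrite mulrAC ler_wpM2r ?nrm_ge0 ?opnormP.
  exists z => x; apply/eqP; rewrite eq_complex zP eqxx/=; apply/eqP.
  have := zP ('i%C *: x); rewrite linearZ/=.
  rewrite !(linearZl_LR (@hdot R _))/=.
  case: (hdot (T x) y) => p q; case: (hdot x z) => p' q' /=.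
  by rewrite !mul0r !mul1r !sub0r => /oppr_inj.
have ls : linear s.
  move=> a y y'; apply: hdot_inj => x; rewrite -sP.
  by rewrite !linearD/= !(linearZr_LR (@hdot R _))/= !sP.
have bs : exists M, forall y, nrm (s y) <= M * nrm y.
  exists (opnorm T) => y.
  have [->|sy0] := eqVneq (nrm (s y)) 0.
    by rewrite mulr_ge0 ?opnorm_ge0 ?nrm_ge0.
  have sy_gt0 : 0 < nrm (s y) by rewrite lt_neqAle eq_sym sy0 nrm_ge0.
  rewrite -(ler_pM2r sy_gt0) -expr2 nrm_sqr -sP.
  apply: le_trans (ler_norm _) _; apply: le_trans (norm_Re_hdot _ _) _.
  by rewrite mulrAC ler_wpM2r ?nrm_ge0 ?opnormP.
by exists (mkbop ls bs) => x y; exact: sP.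
Qed.

Definition adj T : bop K H := projT1 (cid (adj_exists T)).

Lemma adjP T x y : hdot (T x) y = hdot x (adj T y).
Proof. exact: (projT2 (cid (adj_exists T))). Qed.

End Adjoint.

Section L2Coord.
Variables (R : realType) (K : hilbertType R).

Lemma l2_inj_subproof (i : nat) (x : K) :
  (fun j => if j == i then x else 0) \in @is_l2 R K.
Proof.
apply: is_l2_bounded; exists (nrm x ^+ 2) => n.
have [ni|ni] := leqP n i.
  rewrite big_nat big1 ?sqr_ge0// => j /andP[_ jn].
  by rewrite ltn_eqF ?nrm0 ?expr0n// (leq_trans jn).
rewrite (bigD1_seq i) ?iota_uniq ?mem_index_iota//= eqxx big1 ?addr0//.
by move=> j /negPf ->; rewrite nrm0 expr0n.
Qed.

Definition l2_inj_fun i x : l2 K := L2 (l2_inj_subproof i x).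

Lemma l2_inj_linear i : linear (l2_inj_fun i).
Proof.
move=> a x y; apply: eq_l2 => j; rewrite l2ED l2EZ /=.
by case: ifP => // _; rewrite scaler0 addr0.
Qed.

Lemma l2_inj_bounded i : exists M, forall x, nrm (l2_inj_fun i x) <= M * nrm x.
Proof.
exists 1 => x; rewrite mul1r -ler_sqr ?nnegrE ?nrm_ge0//.
apply: nrm_l2_le => n /=.
have [ni|ni] := leqP n i.
  rewrite big_nat big1 ?sqr_ge0// => j /andP[_ jn].
  by rewrite ltn_eqF ?nrm0 ?expr0n// (leq_trans jn).
rewrite (bigD1_seq i) ?iota_uniq ?mem_index_iota//= eqxx big1 ?addr0//.
by move=> j /negPf ->; rewrite nrm0 expr0n.
Qed.

Definition l2_inj i : bop K (l2 K) := mkbop (@l2_inj_linear i) (l2_inj_bounded i).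

Lemma l2_proj_linear i : linear (fun f : l2 K => f i).
Proof. by []. Qed.

Lemma l2_proj_bounded i :
  exists M, forall f : l2 K, nrm (f i) <= M * nrm f.
Proof. by exists 1 => f; rewrite mul1r nrm_l2_coord. Qed.

Definition l2_proj i : bop (l2 K) K :=
  mkbop (@l2_proj_linear i) (l2_proj_bounded i).

Lemma l2_injE i x j : l2_inj i x j = if j == i then x else 0.
Proof. by []. Qed.

Lemma l2_projE i (f : l2 K) : l2_proj i f = f i.
Proof. by []. Qed.

Lemma l2_sumE (I : Type) (r : seq I) (P : pred I) (F : I -> l2 K) j :
  (\sum_(i <- r | P i) F i) j = \sum_(i <- r | P i) F i j.
Proof. by elim/big_rec2: _ => //= i y S _ <-. Qed.

End L2Coord.

Notation "S \ob T" := (bcomp S T) (at level 40, left associativity) : ring_scope.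

Section OperatorSpaces.
Variable R : realType.

Definition is_subspace (V : lmodType R[i]) (X : set V) : Prop :=
  X 0 /\ forall (a : R[i]) x y, X x -> X y -> X (a *: x + y).

Definition lin_span (V : lmodType R[i]) (S : set V) : set V :=
  [set x | exists n (a : 'I_n -> R[i]) (s : 'I_n -> V),
    (forall i, S (s i)) /\ x = \sum_(i < n) a i *: s i].

Definition closed_span (V : normedModType R[i]) (S : set V) : set V :=
  closure (lin_span S).

Definition operator_space (H K : hilbertType R) (X : set (bop H K)) : Prop :=
  is_subspace X /\ closed X.

Definition is_tro (H K : hilbertType R) (M : set (bop H K)) : Prop :=
  operator_space M /\
  forall a b c, M a -> M b -> M c -> M (a \ob adj b \ob c).

Definition strongly_tro_equivalent_by (H1 H2 K1 K2 : hilbertType R)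
    (X : set (bop K1 K2)) (Y : set (bop H1 H2))
    (M1 : set (bop H1 K1)) (M2 : set (bop H2 K2)) : Prop :=
  [/\ is_tro M1, is_tro M2,
    X = closed_span [set T | exists a y b,
          [/\ M2 a, Y y, M1 b & T = a \ob y \ob adj b]] &
    Y = closed_span [set T | exists a x b,
          [/\ M2 a, X x, M1 b & T = adj a \ob x \ob b]]].

Section Matrices.
Variables H K : hilbertType R.

(* The infinite matrix with T in its upper left corner and 0 elsewhere, acting
   on H^(oo): see [mx_opE]. *)
Definition mx_op n (T : 'M[bop H K]_n) : bop (l2 H) (l2 K) :=
  \sum_(i < n) \sum_(j < n) l2_inj K i \ob T i j \ob l2_proj H j.

Definition K_infty (X : set (bop H K)) : set (bop (l2 H) (l2 K)) :=
  closure [set S | exists n (T : 'M[bop H K]_n),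
    (forall i j, X (T i j)) /\ S = mx_op T].

(* The norm of T in M_n(B(H, K)), i.e. as an operator from H^n to K^n. *)
Definition mx_opnorm n (T : 'M[bop H K]_n) : R :=
  sup [set Num.sqrt (\sum_(i < n) nrm (\sum_(j < n) T i j (x j)) ^+ 2) |
       x in [set x : 'I_n -> H | \sum_(j < n) nrm (x j) ^+ 2 <= 1]].

Lemma mx_opnorm_has_sup n (T : 'M[bop H K]_n) :
  has_sup [set Num.sqrt (\sum_(i < n) nrm (\sum_(j < n) T i j (x j)) ^+ 2) |
       x in [set x : 'I_n -> H | \sum_(j < n) nrm (x j) ^+ 2 <= 1]].
Proof.
split.
  exists (Num.sqrt (\sum_(i < n) nrm (\sum_(j < n) T i j (0 : H)) ^+ 2)).
  exists (fun=> 0) => //=; rewrite big1 ?ler01// => j _.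
  by rewrite nrm0 expr0n.
exists (Num.sqrt (\sum_(i < n) (\sum_(j < n) opnorm (T i j)) ^+ 2)).
move=> _ [x /= x1 <-]; apply: ler_wsqrtr; apply: ler_sum => i _.
rewrite ler_sqr ?nnegrE ?nrm_ge0 ?sumr_ge0// => [|j _]; last exact: opnorm_ge0.
have nrm_sum : nrm (\sum_(j < n) T i j (x j)) <= \sum_(j < n) nrm (T i j (x j)).
  elim/big_rec2: _ => [|j a y _ ya]; first by rewrite nrm0.
  by apply: le_trans (nrmD _ _) _; rewrite lerD2l.
apply: le_trans nrm_sum _; apply: ler_sum => j _.
apply: le_trans (opnormP _ _) _; rewrite -[leRHS]mulr1.
apply: ler_wpM2l; first exact: opnorm_ge0.
rewrite -(@ler_pXn2r _ 2)// ?nnegrE ?nrm_ge0// expr1n.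
apply: le_trans x1; rewrite (bigD1 j)//= lerDl sumr_ge0// => k _.
exact: sqr_ge0.
Qed.

Lemma bop_sumE (I : Type) (r : seq I) (P : pred I) (F : I -> bop H K) x :
  (\sum_(i <- r | P i) F i) x = \sum_(i <- r | P i) F i x.
Proof. by elim/big_rec2: _ => //= i y S _ <-. Qed.

End Matrices.

Lemma mx_opE (H K : hilbertType R) n (T : 'M[bop H K]_n) (f : l2 H) (k : nat) :
  mx_op T f k = if insub k is Some i then \sum_(j < n) T i j (f j) else 0.
Proof.
rewrite /mx_op bop_sumE l2_sumE.
have termE (i : 'I_n) : (\sum_(j < n) l2_inj K i \ob T i j \ob l2_proj H j) f k =
    if k == i :> nat then \sum_(j < n) T i j (f j) else 0.
  rewrite bop_sumE l2_sumE; case: ifP => ki.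
    by apply: eq_bigr => j _; rewrite /= ki.
  by rewrite big1// => j _; rewrite /= ki.
under eq_bigr do rewrite termE.
case: insubP => [i _ ik|].
  rewrite (bigD1 i)//= ik eqxx [X in _ + X]big1 ?addr0// => i' i'i.
  by rewrite -ik eq_sym (inj_eq val_inj) (negPf i'i).
rewrite -leqNgt => nk; rewrite big1// => i _.
by rewrite gtn_eqF// (leq_trans (ltn_ord i)).
Qed.

(* [phi] is a total function, but only its restriction to X matters. *)
Definition completely_isometrically_isomorphic (H K H' K' : hilbertType R)
    (X : set (bop H K)) (Y : set (bop H' K')) : Prop :=
  exists phi : bop H K -> bop H' K',
    [/\ forall (a : R[i]) S T, X S -> X T -> phi (a *: S + T) = a *: phi S + phi T,
        set_bij X Y phi &
        forall n (T : 'M[bop H K]_n), (forall i j, X (T i j)) ->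
          mx_opnorm (map_mx phi T) = mx_opnorm T].

Definition stably_isomorphic (H K H' K' : hilbertType R)
    (X : set (bop H K)) (Y : set (bop H' K')) : Prop :=
  completely_isometrically_isomorphic (K_infty X) (K_infty Y).

End OperatorSpaces.

(* Main.v *)
Require Import Defs.
From mathcomp Require Import all_boot all_order all_algebra.
From mathcomp Require Import sesquilinear complex.
From mathcomp Require Import all_classical all_reals all_analysis.
From mathcomp Require Import lra.

Set Implicit Arguments.
Unset Strict Implicit.
Unset Printing Implicit Defensive.

Import Order.TTheory GRing.Theory Num.Theory Num.Def.
Import numFieldTopology.Exports numFieldNormedType.Exports.

Local Open Scope classical_set_scope.
Local Open Scope complex_scope.
Local Open Scope ring_scope.

(** The passage from X to Y is split at Z = [X M1], which is also [M2 Y] because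
   M1 and M2 are ternary rings: X and Z differ by multiplication with M1 on the
   right only, Z and Y by multiplication with M2 on the left only.  Taking adjoints
   exchanges left and right, so a one-sided statement suffices
   ([stably_isomorphic_left]): let m_i and n_i, operators from H to K, multiply a
   space A of operators into H to a space B of operators into K, and let their
   adjoints multiply B back to A; if the sums of the n_i^* n_i converge to the
   identity on A, and those of the m_i m_i^* on B, then A and B are stably
   isomorphic.

   The columns with entries n_i and m_i^* act isometrically on A and on B
   ([isometry_col_op]); the partial sums being contractions makes the columns
   bounded, and convergence in norm keeps their values inside the closed span of
   finitely supported columns.  So A is a complemented part of the column space
   col B of sequences from B, and B a complemented part of col A.  From here the
   argument is that of Brown, Kasparov and Pelczynski.  If E maps A isometrically
   into C, and p = E E^*, then A (+) col C and col C are unitarily equivalent: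
   move the p-part of a sequence one step to the right, leave the (1 - p)-part
   where it is, and put A, through E, into the freed p-part of the first entry
   ([orth_sum_swindle]).  Identifying col (col B) with col B, this gives
   col A (+) col B = col B, and by symmetry also = col A.  The resulting operator U
   from l2 H to l2 K acts as a unitary from col A onto col B
   ([col_space_unitary]).

   Left multiplication by U is then the required complete isometry
   ([unitary_stably_isomorphic]): U^* U fixes each operator in K_oo(A), hence
   each vector in its range, so U preserves the norms of these vectors.

   The approximate units converge only after multiplication with elements of X and
   Y, so the identities T^* T = 1 may fail on the Hilbert spaces themselves.  Therefore
   isometries, unitaries and orthogonal sums are defined below relative to sets of
   operators on which they act by left multiplication. *)

(** * Closed linear spans *)

Section Span.
Variables (R : realType) (V : normedModType R[i]).
Implicit Types (S W : set V) (x y : V).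

Lemma lin_span_subspace S : is_subspace (lin_span S).
Proof.
split; first by exists 0%N, (fun=> 0), (fun=> 0); split; [case|rewrite big_ord0].
move=> c x y [k [a [s [sS ->]]]] [l [b [t [tS ->]]]].
exists (k + l)%N.
exists (fun i : 'I_(k + l) =>
  match fintype.split i with inl j => c * a j | inr j => b j end).
exists (fun i : 'I_(k + l) =>
  match fintype.split i with inl j => s j | inr j => t j end).
split=> [i|]; first by case: (fintype.split i).
rewrite big_split_ord/= scaler_sumr; congr (_ + _); apply: eq_bigr => i _.
  by rewrite (unsplitK (inl i)) scalerA.
by rewrite (unsplitK (inr i)).
Qed.

Lemma lin_span_sub S : S `<=` lin_span S.
Proof.
move=> x Sx; exists 1%N, (fun=> 1), (fun=> x); split=> //.
by rewrite big_ord1 scale1r.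
Qed.

Lemma lin_span_min S W : is_subspace W -> S `<=` W -> lin_span S `<=` W.
Proof.
move=> [W0 WL] SW x [k [a [s [sS ->]]]].
elim/big_rec: _ => // i y _ Wy; apply: WL => //; exact: SW.
Qed.

Lemma closure_nrmP S x :
  closure S x <-> forall e : R, 0 < e -> exists2 y, S y & nrm (x - y) < e.
Proof.
split=> [cx e e0|cx].
  have := cx (ball x e%:C); case.
    by apply: nbhsx_ballx; rewrite ltcR.
  by move=> y [Sy]; rewrite -ball_normE/ball_/= nrm_lt => xy; exists y.
move=> B; rewrite -nbhs_ballE => -[e /= e0].
have eR : e = (complex.Re e)%:C by rewrite RRe_real ?gtr0_real.
have {}e0 : 0 < complex.Re e by rewrite -ltcR -eR.
have [y Sy xy] := cx _ e0; move/(_ y) => eB; exists y; split=> //; apply: eB.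
by rewrite -ball_normE/ball_/= eR nrm_lt.
Qed.

Lemma closure_subspace W : is_subspace W -> is_subspace (closure W).
Proof.
move=> [W0 WL]; split; first exact: subset_closure.
move=> c x y /closure_nrmP cx /closure_nrmP cy.
apply/closure_nrmP => e e0.
set N := complex.Re `|c|.
have N0 : 0 <= N by rewrite -ler0c RRe_real ?normr_real ?normr_ge0.
have N1 : 0 < N + 1 by rewrite ltr_wpDl.
have [x' Wx' xx'] := cx (e / 2 / (N + 1)) ltac:(rewrite !divr_gt0//).
have [y' Wy' yy'] := cy (e / 2) ltac:(rewrite divr_gt0//).
exists (c *: x' + y'); first exact: WL.
rewrite opprD addrACA -scalerBr (le_lt_trans (nrmD _ _))//.
rewrite [ltRHS](splitr e) ler_ltD// nrmZ -/N.
rewrite -[leRHS](divfK (lt0r_neq0 N1)) [leRHS]mulrC.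
by rewrite ler_pM ?nrm_ge0 ?(ltW xx')// lerDl.
Qed.

Lemma closed_span_subspace S : is_subspace (closed_span S).
Proof. exact/closure_subspace/lin_span_subspace. Qed.

Lemma closed_span_closed S : closed (closed_span S).
Proof. exact: closed_closure. Qed.

Lemma closed_span_sub S : S `<=` closed_span S.
Proof. by move=> x Sx; apply/subset_closure/lin_span_sub. Qed.

Lemma closed_span_min S W :
  is_subspace W -> closed W -> S `<=` W -> closed_span S `<=` W.
Proof.
move=> sW cW SW; rewrite (closure_id W).1//.
by apply: closure_subset; apply: lin_span_min.
Qed.

Lemma subspaceD W x y : is_subspace W -> W x -> W y -> W (x + y).
Proof. by move=> [_ /(_ 1 x y)]; rewrite scale1r. Qed.

Lemma subspaceN W x : is_subspace W -> W x -> W (- x).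
Proof.
by move=> [W0 WL] Wx; have := WL (-1) x 0 Wx W0; rewrite scaleN1r addr0.
Qed.

Lemma subspaceB W x y : is_subspace W -> W x -> W y -> W (x - y).
Proof. by move=> sW Wx Wy; apply: subspaceD => //; apply: subspaceN. Qed.

Lemma subspace_sum W (I : Type) (r : seq I) (P : pred I) (F : I -> V) :
  is_subspace W -> (forall i, P i -> W (F i)) -> W (\sum_(i <- r | P i) F i).
Proof.
move=> sW WF; elim/big_rec: _ => [|i y Pi Wy]; first by case: sW.
exact: subspaceD (WF _ Pi) Wy.
Qed.

End Span.

Section LipschitzMaps.
Variables (R : realType) (V V' : normedModType R[i]).

Lemma nrm_lip_continuous (f : V -> V') (M : R) :
  (forall x y, nrm (f x - f y) <= M * nrm (x - y)) -> continuous f.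
Proof.
move=> fM x; apply/cvg_nrmP => e e0.
have M1 : 0 < `|M| + 1 by rewrite ltr_wpDl.
have /cvg_nrmP/(_ (e / (`|M| + 1))) : y @[y --> x] --> x by [].
rewrite divr_gt0// => /(_ isT); apply: filterS => y.
rewrite ltr_pdivlMr// mulrC; apply: le_lt_trans; apply: le_trans (fM _ _) _.
by rewrite ler_wpM2r ?nrm_ge0// (le_trans (ler_norm _))// lerDl.
Qed.

Lemma closed_span_preim (f : V -> V') (S : set V) (W : set V') :
  linear f -> continuous f -> is_subspace W -> closed W ->
  (forall x, S x -> W (f x)) -> forall x, closed_span S x -> W (f x).
Proof.
move=> lf cf sW cW SW; apply: (@closed_span_min _ _ S (f @^-1` W)) => //.
- have f0 : f 0 = 0 by have := lf (-1) 0 0; rewrite !scaleN1r !addNr.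
  split=> [|a x y Wx Wy]; first by rewrite /preimage/= f0; case: sW.
  by rewrite /preimage/= lf; case: sW => _; apply.
- by apply: closed_comp => // x _; exact: cf.
Qed.

End LipschitzMaps.

(** * Composition and adjoints of bounded operators *)

Section BopAlgebra.
Variable R : realType.

Section Compose.
Variables H K L : hilbertType R.
Implicit Types (S : bop K L) (T : bop H K).

Lemma bcomp_linear S : linear (fun T : bop H K => S \ob T).
Proof. by move=> a T U; apply: eq_bop => x; exact: (linearP S). Qed.

Lemma bcompr_linear T : linear (fun S : bop K L => S \ob T).
Proof. by move=> a S U; apply: eq_bop. Qed.

Lemma bcompDl S S' T : (S + S') \ob T = S \ob T + S' \ob T.
Proof. exact: eq_bop. Qed.

Lemma bcompDr S T T' : S \ob (T + T') = S \ob T + S \ob T'.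
Proof. by apply: eq_bop => x /=; rewrite linearD. Qed.

Lemma bcompBl S S' T : (S - S') \ob T = S \ob T - S' \ob T.
Proof. exact: eq_bop. Qed.

Lemma bcompBr S T T' : S \ob (T - T') = S \ob T - S \ob T'.
Proof. by apply: eq_bop => x /=; rewrite linearB. Qed.

Lemma bcomp0l T : (0 : bop K L) \ob T = 0.
Proof. exact: eq_bop. Qed.

Lemma bcomp0r S : S \ob (0 : bop H K) = 0.
Proof. by apply: eq_bop => x /=; rewrite linear0. Qed.

Lemma bcomp_suml (I : Type) (r : seq I) (P : pred I) (F : I -> bop K L) T :
  (\sum_(i <- r | P i) F i) \ob T = \sum_(i <- r | P i) F i \ob T.
Proof.
by elim/big_rec2: _ => [|i y S _ <-]; rewrite ?bcomp0l// bcompDl.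
Qed.

Lemma bcomp_sumr (I : Type) (r : seq I) (P : pred I) (F : I -> bop H K) S :
  S \ob (\sum_(i <- r | P i) F i) = \sum_(i <- r | P i) S \ob F i.
Proof.
by elim/big_rec2: _ => [|i y T _ <-]; rewrite ?bcomp0r// bcompDr.
Qed.

Lemma opnorm_comp S T : opnorm (S \ob T) <= opnorm S * opnorm T.
Proof.
apply: opnorm_le => [|x]; first by rewrite mulr_ge0 ?opnorm_ge0.
by rewrite (le_trans (opnormP S _))// -mulrA ler_wpM2l ?opnorm_ge0 ?opnormP.
Qed.

Lemma bcomp_continuous S : continuous (fun T : bop H K => S \ob T).
Proof.
apply: (@nrm_lip_continuous _ _ _ _ (opnorm S)) => T T'.
by rewrite -bcompBr opnorm_comp.
Qed.

Lemma bcompr_continuous T : continuous (fun S : bop K L => S \ob T).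
Proof.
apply: (@nrm_lip_continuous _ _ _ _ (opnorm T)) => S S'.
by rewrite -bcompBl mulrC opnorm_comp.
Qed.

Lemma bcomp_closed_span S (Z : set (bop H K)) (W : set (bop H L)) :
  is_subspace W -> closed W -> (forall T, Z T -> W (S \ob T)) ->
  forall T, closed_span Z T -> W (S \ob T).
Proof.
move=> sW cW ZW; apply: closed_span_preim => //; first exact: bcomp_linear.
exact: bcomp_continuous.
Qed.

Lemma bcompr_closed_span T (Z : set (bop K L)) (W : set (bop H L)) :
  is_subspace W -> closed W -> (forall S, Z S -> W (S \ob T)) ->
  forall S, closed_span Z S -> W (S \ob T).
Proof.
move=> sW cW ZW; apply: (@closed_span_preim _ _ _ (fun S => S \ob T)) => //.
  exact: bcompr_linear.
exact: bcompr_continuous.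
Qed.

End Compose.

Lemma bcompA (H K L G : hilbertType R) (S : bop L G) (T : bop K L) (U : bop H K) :
  S \ob (T \ob U) = S \ob T \ob U.
Proof. exact: eq_bop. Qed.

Lemma bid_subproof (H : hilbertType R) : id \in @is_bop R H H.
Proof. by apply/is_bopP; split=> // x. Qed.

Definition bid (H : hilbertType R) : bop H H := Bop (bid_subproof H).

Lemma bcomp1l (H K : hilbertType R) (T : bop H K) : bid K \ob T = T.
Proof. exact: eq_bop. Qed.

Section Adj.
Variables H K : hilbertType R.
Implicit Types (T : bop H K) (S : bop K H).

Lemma adj_unique T S : (forall x y, hdot (T x) y = hdot x (S y)) -> adj T = S.
Proof.
by move=> TS; apply: eq_bop => y; apply: hdot_inj => x; rewrite -adjP TS.
Qed.

Lemma hdot_adjl T x y : hdot (adj T y) x = hdot y (T x).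
Proof. by rewrite hdotC -adjP [RHS]hdotC. Qed.

Lemma adjD T T' : adj (T + T') = adj T + adj T'.
Proof.
apply: adj_unique => x y.
by rewrite !bopED linearDl linearD/= !adjP.
Qed.

Lemma adjZ a T : adj (a *: T) = a^*%C *: adj T.
Proof.
apply: adj_unique => x y; rewrite !bopEZ (linearZr_LR (@hdot R H))/=.
by rewrite (linearZl_LR (@hdot R K))/= adjP -[_^*]/(_^*%C) conjcK.
Qed.

Lemma adjN T : adj (- T) = - adj T.
Proof.
by apply: adj_unique => x y; rewrite /= linearNl linearN/= adjP.
Qed.

Lemma adjB T T' : adj (T - T') = adj T - adj T'.
Proof. by rewrite adjD adjN. Qed.

Lemma adj0 : adj (0 : bop H K) = 0.
Proof. by rewrite -(subrr (0 : bop H K)) adjB subrr. Qed.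

Lemma adj_sum (I : Type) (r : seq I) (P : pred I) (F : I -> bop H K) :
  adj (\sum_(i <- r | P i) F i) = \sum_(i <- r | P i) adj (F i).
Proof. by elim/big_rec2: _ => [|i y T _ <-]; rewrite ?adj0// adjD. Qed.

Lemma opnorm_adj_le T : opnorm (adj T) <= opnorm T.
Proof.
apply: opnorm_le => [|y]; first exact: opnorm_ge0.
have [->|sy0] := eqVneq (nrm (adj T y)) 0.
  by rewrite mulr_ge0 ?opnorm_ge0 ?nrm_ge0.
have sy_gt0 : 0 < nrm (adj T y) by rewrite lt_neqAle eq_sym sy0 nrm_ge0.
rewrite -(ler_pM2r sy_gt0) -expr2 nrm_sqr -adjP.
apply: le_trans (ler_norm _) _; apply: le_trans (norm_Re_hdot _ _) _.
by rewrite mulrAC ler_wpM2r ?nrm_ge0 ?opnormP.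
Qed.

End Adj.

Lemma adjK (H K : hilbertType R) (T : bop H K) : adj (adj T) = T.
Proof. by apply: adj_unique => x y; rewrite hdot_adjl. Qed.

Lemma adj_comp (H K L : hilbertType R) (S : bop K L) (T : bop H K) :
  adj (S \ob T) = adj T \ob adj S.
Proof. by apply: adj_unique => x y; rewrite /= !adjP. Qed.

Lemma adj1 (H : hilbertType R) : adj (bid H) = bid H.
Proof. exact: adj_unique. Qed.

Lemma opnorm_adj (H K : hilbertType R) (T : bop H K) : opnorm (adj T) = opnorm T.
Proof. by apply/eqP; rewrite eq_le opnorm_adj_le -{1}(adjK T) opnorm_adj_le. Qed.

Lemma adj_continuous (H K : hilbertType R) : continuous (@adj R H K).
Proof.
apply: (@nrm_lip_continuous _ _ _ _ 1) => S T.
by rewrite mul1r -adjB -[leLHS]/(opnorm _) opnorm_adj.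
Qed.

Lemma nrm_sqr_adj (H K : hilbertType R) (T : bop H K) (x : H) :
  nrm (T x) ^+ 2 = complex.Re (hdot ((adj T \ob T) x) x).
Proof. by rewrite nrm_sqr /= hdot_adjl. Qed.

End BopAlgebra.

(** * Operators on l2 sums *)

Section L2Operators.
Variable R : realType.

Lemma limn_series_single (u : R^nat) i :
  (forall j, j != i -> u j = 0) -> limn (series u) = u i.
Proof.
move=> ui; apply: lim_near_cst => //; exists i.+1 => // n /= ni.
by rewrite /series/= (bigD1_seq i) ?iota_uniq ?mem_index_iota//= big1 ?addr0.
Qed.

Lemma ler_sum_subset (I : eqType) (r s : seq I) (F : I -> R) :
  uniq r -> uniq s -> {subset r <= s} -> (forall i, 0 <= F i) ->
  \sum_(i <- r) F i <= \sum_(i <- s) F i.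
Proof.
move=> ur us rs F0; rewrite [leRHS](bigID (mem r))/= -[X in X + _]big_filter.
rewrite (_ : \sum_(i <- [seq _ <- s | _]) F i = \sum_(i <- r) F i).
  by rewrite lerDl sumr_ge0.
apply: perm_big; apply: uniq_perm => //; first exact: filter_uniq.
by move=> i; rewrite mem_filter; case: (boolP (i \in r)) => //= /rs.
Qed.

Lemma nat_pairing : exists (pr : nat * nat -> nat) (un : nat -> nat * nat),
  cancel pr un /\ cancel un pr.
Proof.
have /card_set_bijP[pr] := card_nat2.
by rewrite setTT_bijective => -[un prK unK]; exists pr, un.
Qed.

Section Coordinates.
Variable K : hilbertType R.

Lemma adj_l2_inj i : adj (l2_inj K i) = l2_proj K i.
Proof.
apply: adj_unique => x g; rewrite -[hdot _ g]/(l2_dot _ g) /l2_dot.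
rewrite !(@limn_series_single _ i) => [|j|j]; rewrite ?l2_injE ?eqxx.
- by rewrite l2_projE; case: (hdot _ _).
- by move/negPf=> ->; rewrite linear0l.
- by move/negPf=> ->; rewrite linear0l.
Qed.

Lemma adj_l2_proj i : adj (l2_proj K i) = l2_inj K i.
Proof. by rewrite -adj_l2_inj adjK. Qed.

Lemma l2_projK i : l2_proj K i \ob l2_inj K i = bid K.
Proof. by apply: eq_bop => x; rewrite /= eqxx. Qed.

Lemma l2_proj_inj0 i j : i != j -> l2_proj K i \ob l2_inj K j = 0.
Proof. by move=> /negPf ij; apply: eq_bop => x; rewrite /= ij. Qed.

(** The rows of an operator into l2 K are usually visible from its definition; this
   turns them into the columns of its adjoint. *)
Lemma adj_comp_l2_inj (L : hilbertType R) (T : bop L (l2 K)) i :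
  adj T \ob l2_inj K i = adj (l2_proj K i \ob T).
Proof. by rewrite adj_comp adj_l2_proj. Qed.

End Coordinates.

Section Amplification.
Variables H K : hilbertType R.

Section Amp.
Variable T : bop H K.

Lemma amp_subproof (f : l2 H) : (fun i => T (f i)) \in @is_l2 R K.
Proof.
apply: is_l2_bounded; exists (opnorm T ^+ 2 * nrm f ^+ 2) => n.
apply: le_trans (ler_wpM2l (sqr_ge0 _) (nrm_l2_partial f n)).
rewrite mulr_sumr ler_sum// => i _.
by rewrite -exprMn ler_sqr ?nnegrE ?mulr_ge0 ?nrm_ge0 ?opnorm_ge0 ?opnormP.
Qed.

Lemma amp_linear : linear (fun f => L2 (amp_subproof f)).
Proof. by move=> a f g; apply: eq_l2 => i; exact: (linearP T). Qed.

Lemma amp_bounded : exists M, forall f, nrm (L2 (amp_subproof f)) <= M * nrm f.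
Proof.
exists (opnorm T) => f.
rewrite -ler_sqr ?nnegrE ?mulr_ge0 ?nrm_ge0 ?opnorm_ge0//.
apply: nrm_l2_le => n; rewrite exprMn.
apply: le_trans (ler_wpM2l (sqr_ge0 _) (nrm_l2_partial f n)).
rewrite mulr_sumr ler_sum// => i _.
by rewrite -exprMn ler_sqr ?nnegrE ?mulr_ge0 ?nrm_ge0 ?opnorm_ge0 ?opnormP.
Qed.

(** The diagonal operator with T at every place; the name stands for
   amplification. *)
Definition amp : bop (l2 H) (l2 K) := mkbop amp_linear amp_bounded.

Lemma amp_inj i : amp \ob l2_inj H i = l2_inj K i \ob T.
Proof.
apply: eq_bop => x; apply: eq_l2 => j /=.
by case: ifP => // _; rewrite linear0.
Qed.

Lemma proj_amp i : l2_proj K i \ob amp = T \ob l2_proj H i.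
Proof. exact: eq_bop. Qed.

End Amp.
End Amplification.

Lemma adj_amp_inj (H K : hilbertType R) (T : bop H K) i :
  adj (amp T) \ob l2_inj K i = l2_inj H i \ob adj T.
Proof. by rewrite adj_comp_l2_inj proj_amp adj_comp adj_l2_proj. Qed.

Section Shift.
Variable H : hilbertType R.

Lemma shift_subproof (f : l2 H) :
  (fun i => if i is j.+1 then f j else 0) \in @is_l2 R H.
Proof.
apply: is_l2_bounded; exists (nrm f ^+ 2) => -[|n].
  by rewrite big_geq// sqr_ge0.
rewrite big_nat_recl//= nrm0 expr0n add0r; exact: nrm_l2_partial.
Qed.

Lemma shift_linear : linear (fun f => L2 (shift_subproof f)).
Proof.
by move=> a f g; apply: eq_l2 => -[|i]; rewrite l2ED l2EZ//= scaler0 addr0.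
Qed.

Lemma shift_bounded : exists M, forall f, nrm (L2 (shift_subproof f)) <= M * nrm f.
Proof.
exists 1 => f; rewrite mul1r -ler_sqr ?nnegrE ?nrm_ge0//.
apply: nrm_l2_le => -[|n]; first by rewrite big_geq// sqr_ge0.
rewrite big_nat_recl//= nrm0 expr0n add0r; exact: nrm_l2_partial.
Qed.

Definition shift : bop (l2 H) (l2 H) := mkbop shift_linear shift_bounded.

Lemma shift_inj i : shift \ob l2_inj H i = l2_inj H i.+1.
Proof. by apply: eq_bop => x; apply: eq_l2 => -[|j]. Qed.

Lemma adj_shift_inj0 : adj shift \ob l2_inj H 0 = 0.
Proof.
rewrite adj_comp_l2_inj (_ : _ \ob _ = 0) ?adj0//; exact: eq_bop.
Qed.

Lemma adj_shift_injS i : adj shift \ob l2_inj H i.+1 = l2_inj H i.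
Proof.
rewrite adj_comp_l2_inj -[RHS]adj_l2_proj; congr adj; exact: eq_bop.
Qed.

End Shift.

Section ColumnOperator.
Variables (H K : hilbertType R) (c : nat -> bop H K).
Hypothesis c_le1 : forall k x, \sum_(0 <= i < k) nrm (c i x) ^+ 2 <= nrm x ^+ 2.

Lemma col_op_subproof x : (fun i => c i x) \in @is_l2 R K.
Proof. by apply: is_l2_bounded; exists (nrm x ^+ 2) => k. Qed.

Lemma col_op_linear : linear (fun x => L2 (col_op_subproof x)).
Proof. by move=> a x y; apply: eq_l2 => i; exact: (linearP (c i)). Qed.

Lemma col_op_bounded : exists M, forall x, nrm (L2 (col_op_subproof x)) <= M * nrm x.
Proof.
exists 1 => x; rewrite mul1r -ler_sqr ?nnegrE ?nrm_ge0//.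
by apply: nrm_l2_le => k; exact: c_le1.
Qed.

Definition col_op : bop H (l2 K) := mkbop col_op_linear col_op_bounded.

Lemma adj_col_op_inj i : adj col_op \ob l2_inj K i = adj (c i).
Proof. by rewrite adj_comp_l2_inj; congr adj; exact: eq_bop. Qed.

End ColumnOperator.

Section Flatten.
Variables (H : hilbertType R) (pr : nat * nat -> nat) (un : nat -> nat * nat).
Hypotheses (prK : cancel pr un) (unK : cancel un pr).
Implicit Types f g : l2 (l2 H).

(** The first k entries of the flattened sequence lie in an N by N square of the
   double sequence. *)
Lemma flatten_partial f k :
  \sum_(0 <= i < k) nrm (f (un i).1 (un i).2) ^+ 2 <= nrm f ^+ 2.
Proof.
pose N := (\max_(i < k) (maxn (un i).1 (un i).2).+1)%N.
have ltN i : (i < k)%N -> ((un i).1 < N)%N && ((un i).2 < N)%N.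
  move=> ik; rewrite -gtn_max.
  exact: (leq_bigmax (F := fun j : 'I_k => (maxn (un j).1 (un j).2).+1)
    (Ordinal ik)).
apply: (@le_trans _ _ (\sum_(0 <= j < N) \sum_(0 <= i < N) nrm (f j i) ^+ 2)).
  rewrite -(big_map un xpredT (fun p => nrm (f p.1 p.2) ^+ 2)).
  rewrite [leRHS](_ : _ = \sum_(p <- [seq (j, i) | j <- index_iota 0 N,
    i <- index_iota 0 N]) nrm (f p.1 p.2) ^+ 2); last by rewrite big_allpairs.
  apply: ler_sum_subset.
  - by rewrite (map_inj_uniq (can_inj unK)) iota_uniq.
  - by rewrite allpairs_uniq ?iota_uniq// => -[? ?] [].
  - move=> _ /mapP[i + ->]; rewrite mem_index_iota => /andP[_ /ltN/andP[i1 i2]].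
    by apply/allpairsP; exists (un i); rewrite !mem_index_iota i1 i2 -surjective_pairing.
  - by move=> p; rewrite sqr_ge0.
apply: le_trans (nrm_l2_partial f N); apply: ler_sum => j _.
exact: nrm_l2_partial.
Qed.

Lemma flatten_subproof f : (fun i => f (un i).1 (un i).2) \in @is_l2 R H.
Proof.
by apply: is_l2_bounded; exists (nrm f ^+ 2) => k; exact: flatten_partial.
Qed.

Lemma flatten_linear : linear (fun f => L2 (flatten_subproof f)).
Proof. by move=> a f g; apply: eq_l2. Qed.

Lemma flatten_bounded :
  exists M, forall f, nrm (L2 (flatten_subproof f)) <= M * nrm f.
Proof.
exists 1 => f; rewrite mul1r -ler_sqr ?nnegrE ?nrm_ge0//.
by apply: nrm_l2_le => k; exact: flatten_partial.
Qed.

Definition flatten_op : bop (l2 (l2 H)) (l2 H) :=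
  mkbop flatten_linear flatten_bounded.

Lemma flatten_op_inj j i :
  flatten_op \ob l2_inj (l2 H) j \ob l2_inj H i = l2_inj H (pr (j, i)).
Proof.
apply: eq_bop => x; apply: eq_l2 => n /=; rewrite -(can2_eq unK prK).
by case: (un n) => p q /=; rewrite xpair_eqE; case: (p == j).
Qed.

Lemma adj_flatten_op_inj n :
  adj flatten_op \ob l2_inj H n = l2_inj (l2 H) (un n).1 \ob l2_inj H (un n).2.
Proof.
rewrite adj_comp_l2_inj -!adj_l2_proj -adj_comp.
by congr adj; exact: eq_bop.
Qed.

End Flatten.
End L2Operators.

(** * Column spaces and the decomposition argument *)

Section ColumnSpaces.
Variables (R : realType) (L : hilbertType R).

Section Definitions.
Variables H K : hilbertType R.
Implicit Types (A : set (bop L H)) (B : set (bop L K)) (T : bop H K).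

(** The column analogue of [K_infty]. *)
Definition col_space A : set (bop L (l2 H)) :=
  closed_span [set T | exists i a, A a /\ T = l2_inj H i \ob a].

(** The operators that act from A to B in the sense of Hilbert modules: the adjoint
   must map back, a condition that plain bounded operators need not satisfy. *)
Definition adjointable A B T : Prop :=
  (forall a, A a -> B (T \ob a)) /\ (forall b, B b -> A (adj T \ob b)).

Definition isometry A B T : Prop :=
  adjointable A B T /\ forall a, A a -> adj T \ob (T \ob a) = a.

End Definitions.

Definition unitary (H K : hilbertType R) (A : set (bop L H)) (B : set (bop L K))
    (T : bop H K) : Prop :=
  isometry A B T /\ isometry B A (adj T).

(** C is the orthogonal sum of copies E A and S B of A and B. This internal form
   avoids constructing a direct sum of Hilbert spaces. *)
Definition orth_sum (H K G : hilbertType R)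
    (A : set (bop L H)) (B : set (bop L K)) (C : set (bop L G)) : Prop :=
  exists (E : bop H G) (S : bop K G),
    [/\ isometry A C E, isometry B C S,
        forall b, B b -> adj E \ob (S \ob b) = 0,
        forall a, A a -> adj S \ob (E \ob a) = 0 &
        forall c, C c -> E \ob (adj E \ob c) + S \ob (adj S \ob c) = c].

Section Generators.
Variable H : hilbertType R.
Implicit Types A : set (bop L H).

Lemma col_space_subspace A : is_subspace (col_space A).
Proof. exact: closed_span_subspace. Qed.

Lemma col_space_closed A : closed (col_space A).
Proof. exact: closed_span_closed. Qed.

Lemma col_space_inj A i a : A a -> col_space A (l2_inj H i \ob a).
Proof. by move=> Aa; apply: closed_span_sub; exists i, a. Qed.

(** The two principles by which statements on a column space reduce to its
   generators l2_inj H i \ob a, on which amplifications and shifts are computed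
   explicitly. *)
Lemma col_space_map (G : hilbertType R) A (W : set (bop L G)) (T : bop (l2 H) G) :
  is_subspace W -> closed W ->
  (forall i a, A a -> W (T \ob (l2_inj H i \ob a))) ->
  forall d, col_space A d -> W (T \ob d).
Proof.
move=> sW cW TW; apply: bcomp_closed_span => //.
by move=> _ [i [a [Aa ->]]]; exact: TW.
Qed.

Lemma col_space_eq (G : hilbertType R) A (T U : bop (l2 H) G) :
  (forall i a, A a -> T \ob (l2_inj H i \ob a) = U \ob (l2_inj H i \ob a)) ->
  forall d, col_space A d -> T \ob d = U \ob d.
Proof.
move=> TU d Ad; apply/eqP; rewrite -subr_eq0 -bcompBl; apply/eqP.
apply: (@col_space_map _ A [set 0]) Ad => [||i a Aa].
- by split=> // a x y -> ->; rewrite scaler0 addr0.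
- exact/accessible_closed_set1/hausdorff_accessible/norm_hausdorff.
- by rewrite /= bcompBl TU// subrr.
Qed.

End Generators.

Section Actions.
Variables H K : hilbertType R.
Implicit Types (a : bop L H).

Lemma amp_col (T : bop H K) i a :
  amp T \ob (l2_inj H i \ob a) = l2_inj K i \ob (T \ob a).
Proof. by rewrite !bcompA amp_inj. Qed.

Lemma adj_amp_col (T : bop K H) i a :
  adj (amp T) \ob (l2_inj H i \ob a) = l2_inj K i \ob (adj T \ob a).
Proof. by rewrite !bcompA adj_amp_inj. Qed.

Lemma shift_col i a : shift H \ob (l2_inj H i \ob a) = l2_inj H i.+1 \ob a.
Proof. by rewrite bcompA shift_inj. Qed.

Lemma adj_shift_col0 a : adj (shift H) \ob (l2_inj H 0 \ob a) = 0.
Proof. by rewrite bcompA adj_shift_inj0 bcomp0l. Qed.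

Lemma adj_shift_colS i a :
  adj (shift H) \ob (l2_inj H i.+1 \ob a) = l2_inj H i \ob a.
Proof. by rewrite bcompA adj_shift_injS. Qed.

Lemma adj_inj_col i j a :
  adj (l2_inj H j) \ob (l2_inj H i \ob a) = if j == i then a else 0.
Proof.
rewrite bcompA adj_l2_inj; case: eqVneq => [->|ij].
  by rewrite l2_projK bcomp1l.
by rewrite l2_proj_inj0// bcomp0l.
Qed.

End Actions.

Section Adjointable.
Variables H K G : hilbertType R.
Variables (A : set (bop L H)) (B : set (bop L K)) (C : set (bop L G)).

Lemma adjointable_adj T : adjointable A B T -> adjointable B A (adj T).
Proof. by move=> [TA TB]; split=> // a /TA; rewrite adjK. Qed.

Lemma adjointable_comp S T :
  adjointable B C S -> adjointable A B T -> adjointable A C (S \ob T).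
Proof.
move=> [SB SC] [TA TB]; split=> [a Aa|c Cc].
  by rewrite -bcompA; apply/SB/TA.
by rewrite adj_comp -bcompA; apply/TB/SC.
Qed.

Lemma adjointableD S T : is_subspace A -> is_subspace B ->
  adjointable A B S -> adjointable A B T -> adjointable A B (S + T).
Proof.
move=> sA sB [SA SB] [TA TB]; split=> [a Aa|b Bb].
  by rewrite bcompDl; apply: subspaceD (SA _ Aa) (TA _ Aa).
by rewrite adjD bcompDl; apply: subspaceD (SB _ Bb) (TB _ Bb).
Qed.

Lemma isometry_comp S T : isometry B C S -> isometry A B T -> isometry A C (S \ob T).
Proof.
move=> [aS iS] [aT iT]; split; first exact: adjointable_comp aS aT.
move=> a Aa; rewrite adj_comp -!bcompA iS ?iT//; exact: aT.1.
Qed.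

Lemma adjointable_amp T : adjointable A B T -> adjointable (col_space A) (col_space B) (amp T).
Proof.
move=> [TA TB]; have scol := col_space_subspace; have ccol := col_space_closed.
split; apply: col_space_map => // i a Aa; rewrite ?amp_col ?adj_amp_col.
  by apply: col_space_inj; exact: TA.
by apply: col_space_inj; exact: TB.
Qed.

Lemma isometry_amp T : isometry A B T -> isometry (col_space A) (col_space B) (amp T).
Proof.
move=> [aT iT]; split; first exact: adjointable_amp.
move=> d; rewrite bcompA -[RHS]bcomp1l; apply: col_space_eq => i a Aa.
by rewrite -bcompA amp_col adj_amp_col iT// bcomp1l.
Qed.

End Adjointable.

Section OrthSum.

Lemma orth_sumC (H K G : hilbertType R)
    (A : set (bop L H)) (B : set (bop L K)) (C : set (bop L G)) :
  orth_sum A B C -> orth_sum B A C.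
Proof.
move=> [E [S [iE iS ES SE ESc]]]; exists S, E; split=> // c Cc.
by rewrite addrC ESc.
Qed.

(** Transport along F, used to replace col (col B) by col B. *)
Lemma orth_sum_unitary (H K K' : hilbertType R) (A : set (bop L H))
    (C : set (bop L K)) (D : set (bop L K')) (F : bop K K') :
  unitary C D F -> orth_sum A C C -> orth_sum A D D.
Proof.
move=> [iF iF'] [E [S [iE iS ES SE ESc]]].
exists (F \ob E), (F \ob (S \ob adj F)); split.
- exact: isometry_comp iF iE.
- exact/(isometry_comp iF)/(isometry_comp iS iF').
- move=> d Dd; rewrite adj_comp -!bcompA iF.2 ?ES//; first exact: iF'.1.1.
  exact/iS.1.1/iF'.1.1.
- move=> a Aa; rewrite !adj_comp -!bcompA iF.2 ?SE ?bcomp0r//; exact: iE.1.1.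
- move=> d Dd; rewrite !adj_comp -!bcompA -bcompDr adjK.
  rewrite [adj F \ob (F \ob _)]iF.2; last exact/iS.1.2/iF'.1.1.
  rewrite ESc; last exact: iF'.1.1.
  by have := iF'.2 d Dd; rewrite adjK.
Qed.

(** Matching the parts E A with E' A and S B with S' B compares two orthogonal
   sums of the same pair; no identity map on an external direct sum appears. *)
Lemma orth_sum_isometry (H K G G' : hilbertType R)
    (A : set (bop L H)) (B : set (bop L K)) (C : set (bop L G))
    (D : set (bop L G')) E S E' S' :
  is_subspace C -> is_subspace D ->
  isometry A C E -> isometry B C S ->
  (forall c, C c -> E \ob (adj E \ob c) + S \ob (adj S \ob c) = c) ->
  isometry A D E' -> isometry B D S' ->
  (forall b, B b -> adj E' \ob (S' \ob b) = 0) ->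
  (forall a, A a -> adj S' \ob (E' \ob a) = 0) ->
  isometry C D (E' \ob adj E + S' \ob adj S).
Proof.
move=> sC sD [aE iE] [aS iS] ESc [aE' iE'] [aS' iS'] ES' SE'; split.
  apply: adjointableD => //; apply: adjointable_comp; [exact: aE'| |exact: aS'|];
  exact: adjointable_adj.
move=> c Cc; have Ac := aE.2 _ Cc; have Bc := aS.2 _ Cc.
rewrite adjD !adj_comp !adjK !bcompDl !bcompDr -!bcompA.
by rewrite iE'// iS'// ES'// SE'// !bcomp0r addr0 add0r ESc.
Qed.

Lemma orth_sum_unique (H K G G' : hilbertType R)
    (A : set (bop L H)) (B : set (bop L K)) (C : set (bop L G))
    (D : set (bop L G')) :
  is_subspace C -> is_subspace D ->
  orth_sum A B C -> orth_sum A B D -> exists U, unitary C D U.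
Proof.
move=> sC sD [E [S [iE iS ES SE ESc]]] [E' [S' [iE' iS' ES' SE' ESd]]].
exists (E' \ob adj E + S' \ob adj S); split.
  exact: (orth_sum_isometry sC sD iE iS).
rewrite adjD !adj_comp !adjK.
exact: (orth_sum_isometry sD sC iE' iS').
Qed.

(** The swindle. With p = E E^* and q = 1 - p, the operator S moves the p-part of a
   sequence one step to the right and fixes its q-part. What is missing from the
   range of S is the p-part of the first entry, and that is a copy of A. *)
Lemma orth_sum_swindle (H K : hilbertType R)
    (A : set (bop L H)) (C : set (bop L K)) E :
  is_subspace C -> closed C ->
  isometry A C E -> orth_sum A (col_space C) (col_space C).
Proof.
move=> sC cC iE; have [[EA EC] iE'] := iE.
pose p := E \ob adj E; pose q := bid K - p.
have ap : adj p = p by rewrite /p adj_comp adjK.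
have aq : adj q = q by rewrite /q adjB adj1 ap.
have Cp c : C c -> C (p \ob c) by rewrite -bcompA => /EC/EA.
have qE (c : bop L K) : q \ob c = c - p \ob c by rewrite /q bcompBl bcomp1l.
have Cq c : C c -> C (q \ob c).
  by move=> Cc; rewrite qE; apply: subspaceB => //; exact: Cp.
have pp c : C c -> p \ob (p \ob c) = p \ob c.
  by move=> Cc; rewrite /p -!bcompA iE'//; exact: EC.
have pq c : C c -> p \ob (q \ob c) = 0.
  by move=> Cc; rewrite qE bcompBr pp// subrr.
have qp c : C c -> q \ob (p \ob c) = 0 by move=> Cc; rewrite qE pp// subrr.
have qq c : C c -> q \ob (q \ob c) = q \ob c.
  by move=> Cc; rewrite qE pq// subr0.
have pDq (c : bop L K) : p \ob c + q \ob c = c by rewrite qE addrCA subrr addr0.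
have scol := @col_space_subspace K C; have ccol := @col_space_closed K C.
have aamp T : (forall c, C c -> C (T \ob c)) -> adj T = T ->
    adjointable (col_space C) (col_space C) (amp T).
  by move=> CT aT; apply: adjointable_amp; split=> //; rewrite aT.
have ashift : adjointable (col_space C) (col_space C) (shift K).
  split; apply: col_space_map => // i c Cc.
    by rewrite shift_col; exact: col_space_inj.
  case: i => [|i]; rewrite ?adj_shift_col0 ?adj_shift_colS; first by case: scol.
  exact: col_space_inj.
(* The action of S and of its adjoint on the generators determines the rest. *)
pose S := shift K \ob amp p + amp q.
have Sc i (c : bop L K) : S \ob (l2_inj K i \ob c) =
    l2_inj K i.+1 \ob (p \ob c) + l2_inj K i \ob (q \ob c).
  by rewrite /S bcompDl -bcompA !amp_col shift_col.
have aSc i (c : bop L K) : adj S \ob (l2_inj K i \ob c) =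
    (if i is j.+1 then l2_inj K j \ob (p \ob c) else 0) + l2_inj K i \ob (q \ob c).
  rewrite /S adjD adj_comp bcompDl -bcompA adj_amp_col aq; congr (_ + _).
  case: i => [|i]; first by rewrite adj_shift_col0 bcomp0r.
  by rewrite adj_shift_colS adj_amp_col ap.
have aS : adjointable (col_space C) (col_space C) S.
  apply: adjointableD => //; last exact: aamp.
  by apply: adjointable_comp ashift _; exact: aamp.
exists (l2_inj K 0 \ob E), S; split.
- split; last by move=> a Aa; rewrite adj_comp -!bcompA adj_inj_col eqxx iE'.
  split=> [a Aa|d Cd].
    by rewrite -bcompA; apply: col_space_inj; exact: EA.
  rewrite adj_comp -bcompA; apply: EC.
  apply: col_space_map Cd => // i c Cc; rewrite adj_inj_col.
  by case: ifP => // _; case: sC.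
- split=> // d Cd; rewrite bcompA -[RHS]bcomp1l.
  apply: col_space_eq Cd => i c Cc; rewrite -bcompA Sc bcompDr !aSc.
  rewrite pp// qp// qq// bcomp0r addr0 bcomp1l.
  by case: i => [|i]; rewrite ?pq// ?bcomp0r add0r -bcompDr pDq.
- move=> d Cd; rewrite bcompA -[RHS](bcomp0l _ d); apply: col_space_eq Cd => i c Cc.
  rewrite bcomp0l -bcompA Sc adj_comp -!bcompA bcompDr !adj_inj_col add0r.
  case: eqP => _; last by rewrite bcomp0r.
  by rewrite qE bcompBr /p -bcompA iE' ?subrr//; exact: EC.
- move=> a Aa; rewrite -bcompA aSc add0r qE /p -bcompA iE'// subrr.
  by rewrite bcomp0r.
- move=> d Cd; rewrite !bcompA -bcompDl -[RHS]bcomp1l.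
  apply: col_space_eq Cd => i c Cc; rewrite bcompDl bcomp1l adj_comp -!bcompA.
  rewrite adj_inj_col aSc bcompDr Sc qq//.
  case: i => [|i] /=; rewrite ?bcomp0r ?Sc.
    by rewrite add0r pq// bcomp0r add0r (bcompA E) -bcompDr pDq.
  by rewrite pp// qp// !bcomp0r pq// bcomp0r !add0r addr0 -bcompDr pDq.
Qed.

End OrthSum.
End ColumnSpaces.

(** * Column isometries *)

Section ColumnIsometry.
Variables (R : realType) (L H K : hilbertType R).
Variables (A : set (bop L H)) (B : set (bop L K)) (c : nat -> bop H K).
Hypothesis c_le1 : forall k, `|\sum_(i < k) adj (c i) \ob c i| <= 1.

Lemma sum_nrm_sqr k x : \sum_(0 <= i < k) nrm (c i x) ^+ 2 =
  complex.Re (hdot ((\sum_(i < k) adj (c i) \ob c i) x) x).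
Proof.
rewrite big_mkord bop_sumE.
rewrite (big_morph (fun u => complex.Re (hdot u x)) (op1 := +%R) (id1 := 0)) => [|u v|].
- by apply: eq_bigr => i _; rewrite nrm_sqr_adj.
- by rewrite linearDl raddfD.
- by rewrite linear0l.
Qed.

(** Contractivity of the partial sums is what makes the column with entries c i a
   bounded operator into l2 K. *)
Lemma col_le1 k x : \sum_(0 <= i < k) nrm (c i x) ^+ 2 <= nrm x ^+ 2.
Proof.
have := c_le1 k; rewrite normr_bop -[1]/(1%:C) lecR sum_nrm_sqr => c1.
apply: le_trans (ler_norm _) _; apply: le_trans (norm_Re_hdot _ _) _.
rewrite expr2 ler_wpM2r ?nrm_ge0//; apply: le_trans (opnormP _ _) _.
by rewrite -[leRHS]mul1r ler_wpM2r ?nrm_ge0.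
Qed.

Let T := col_op col_le1.
Let P k := \sum_(i < k) adj (c i) \ob c i.
Let U k : bop H (l2 K) := \sum_(i < k) l2_inj K i \ob c i.

(** The first k entries of the column take the share <P k x, x> of |x|^2, so
   little is left for the others once P k x is close to x. *)
Lemma col_op_tail k x : nrm ((T - U k) x) ^+ 2 <= nrm (x - P k x) * nrm x.
Proof.
have Ux j : U k x j = if (j < k)%N then c j x else 0.
  rewrite /U bop_sumE l2_sumE; case: ltnP => [jk|kj].
    rewrite (bigD1 (Ordinal jk))//= eqxx big1 ?addr0// => i ij.
    by case: eqP => // ji; case/eqP: ij; exact/val_inj.
  by rewrite big1// => i _ /=; rewrite gtn_eqF// (leq_trans _ kj).
have Dx j : nrm ((T - U k) x j) ^+ 2 = if (j < k)%N then 0 else nrm (c j x) ^+ 2.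
  have -> : (T - U k) x j = c j x - U k x j by [].
  by rewrite Ux; case: ifP => _; rewrite ?subr0// subrr nrm0 expr0n.
apply: (@le_trans _ _ (nrm x ^+ 2 - \sum_(0 <= i < k) nrm (c i x) ^+ 2)); last first.
  rewrite sum_nrm_sqr nrm_sqr -raddfB/= -linearBl.
  by apply: le_trans (ler_norm _) _; exact: norm_Re_hdot.
apply: nrm_l2_le => n; rewrite lerBrDl.
apply: le_trans (col_le1 (k + n) x).
rewrite [leRHS](@big_cat_nat _ _ _ k) ?leq_addr//= lerD2l.
under eq_bigr do rewrite Dx.
apply: (@le_trans _ _ (\sum_(0 <= i < k + n)
    if (i < k)%N then 0 else nrm (c i x) ^+ 2)).
  rewrite [leRHS](@big_cat_nat _ _ _ n) ?leq_addl//= lerDl sumr_ge0// => i _.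
  by case: ifP => // _; exact: sqr_ge0.
rewrite (@big_cat_nat _ _ _ k) ?leq_addr//= big_nat big1 ?add0r => [|i /andP[_ ->]//].
rewrite big_nat [leRHS]big_nat ler_sum// => i /andP[ki _].
by rewrite ltnNge ki.
Qed.

Lemma col_op_cvg (a : bop L H) :
  P k \ob a @[k --> \oo] --> a -> U k \ob a @[k --> \oo] --> T \ob a.
Proof.
move=> /cvg_nrmP Pa; apply/cvg_nrmP => e e0.
have M1 : 0 < opnorm a + 1 by rewrite ltr_wpDl ?opnorm_ge0.
have /Pa : 0 < e ^+ 2 / 4 / (opnorm a + 1) by rewrite !divr_gt0// exprn_gt0.
apply: filterS => k; rewrite ltr_pdivlMr// => ak.
rewrite -bcompBl; apply: (@le_lt_trans _ _ (e / 2)); last first.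
  by rewrite ltr_pdivrMr// ltr_pMr// ltr1n.
have e_ge0 := ltW e0; apply: opnorm_le => [|x]; first by rewrite divr_ge0.
rewrite -ler_sqr ?nnegrE ?mulr_ge0 ?nrm_ge0//.
apply: le_trans (col_op_tail k (a x)) _.
rewrite -[a x - _]/((a - P k \ob a) x) exprMn expr_div_n -natrX.
apply: le_trans (ler_wpM2r _ (ltW ak)); last exact: sqr_ge0.
rewrite expr2 mulrACA ler_pM ?nrm_ge0 ?opnormP//.
apply: le_trans (opnormP _ _) _; rewrite ler_wpM2r ?nrm_ge0//.
by rewrite lerDl.
Qed.

(** The finite columns U k \ob a converge to T \ob a in norm, so T \ob a stays in
   the column space, and adj T \ob T is the limit of the P k on A. *)
Lemma isometry_col_op : is_subspace A -> closed A ->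
  (forall i a, A a -> B (c i \ob a)) ->
  (forall i b, B b -> A (adj (c i) \ob b)) ->
  (forall a, A a -> P k \ob a @[k --> \oo] --> a) ->
  isometry A (col_space B) T.
Proof.
move=> sA cA cB cA' cvP.
have cvU a : A a -> U k \ob a @[k --> \oo] --> T \ob a.
  by move=> /cvP; exact: col_op_cvg.
split; [split|] => [a Aa||a Aa].
- apply: (@closed_cvg _ _ _ _ _ (col_space B) _ _ _ (cvU _ Aa)).
    exact: col_space_closed.
  apply: nearW => k; rewrite /U bcomp_suml.
  apply: subspace_sum => [|i _]; first exact: col_space_subspace.
  by rewrite -bcompA; apply: col_space_inj; exact: cB.
- apply: col_space_map => // i b Bb.
  by rewrite bcompA adj_col_op_inj; exact: cA'.
- have cv1 : adj T \ob (U k \ob a) @[k --> \oo] --> adj T \ob (T \ob a).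
    by apply: continuous_cvg (cvU _ Aa); exact: bcomp_continuous.
  apply: cvg_unique cv1 _; first exact: norm_hausdorff.
  rewrite (_ : (fun k => _) = (fun k => P k \ob a)); first exact: cvP.
  apply/funext => k; rewrite bcompA /U bcomp_sumr; congr (_ \ob _).
  by apply: eq_bigr => i _; rewrite bcompA adj_col_op_inj.
Qed.

End ColumnIsometry.

Section ColumnStabilisation.
Variables (R : realType) (L : hilbertType R).

Lemma unitary_flatten (H : hilbertType R) (A : set (bop L H)) :
  exists F, unitary (col_space (col_space A)) (col_space A) F.
Proof.
have [pr [un [prK unK]]] := nat_pairing.
pose F := flatten_op H unK; exists F.
have Fji i j (a : bop L H) :
    F \ob (l2_inj _ j \ob (l2_inj H i \ob a)) = l2_inj H (pr (j, i)) \ob a.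
  by rewrite !bcompA (flatten_op_inj _ prK).
have aFn k (a : bop L H) : adj F \ob (l2_inj H k \ob a) =
    l2_inj _ (un k).1 \ob (l2_inj H (un k).2 \ob a).
  by rewrite !bcompA adj_flatten_op_inj.
have scol := @col_space_subspace R L; have ccol := @col_space_closed R L.
have FA d : col_space (col_space A) d -> col_space A (F \ob d).
  apply: col_space_map => // j d' Ad'; rewrite bcompA.
  apply: col_space_map Ad' => // i a Aa; rewrite -bcompA Fji.
  exact: col_space_inj.
have FA' d : col_space A d -> col_space (col_space A) (adj F \ob d).
  apply: col_space_map => // k a Aa; rewrite aFn.
  exact/col_space_inj/col_space_inj.
have aF : adjointable (col_space (col_space A)) (col_space A) F by split.
split; split; rewrite ?adjK//; last 2 first.
- exact: adjointable_adj.
- move=> d; rewrite bcompA -[RHS]bcomp1l; apply: col_space_eq => k a Aa.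
  by rewrite bcomp1l -bcompA aFn Fji -surjective_pairing unK.
- move=> d; rewrite bcompA -[RHS]bcomp1l; apply: col_space_eq => j d' Ad'.
  rewrite bcomp1l !bcompA; apply: col_space_eq Ad' => i a Aa.
  by rewrite -!bcompA Fji aFn prK.
Qed.

(** An isometry of A into col B amplifies to one of col A into col (col B), which
   is col B again, so the swindle applies to it. *)
Lemma orth_sum_absorb (H K : hilbertType R) (A : set (bop L H))
    (B : set (bop L K)) T :
  isometry A (col_space B) T ->
  orth_sum (col_space A) (col_space B) (col_space B).
Proof.
move=> iT; have [F uF] := unitary_flatten B; apply: (orth_sum_unitary uF).
apply: (orth_sum_swindle (E := F \ob amp T)).
- exact: col_space_subspace.
- exact: col_space_closed.
- exact: isometry_comp uF.1 (isometry_amp iT).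
Qed.

(** Both column spaces are the orthogonal sum of col A and col B. *)
Lemma col_space_unitary (H K : hilbertType R) (A : set (bop L H))
    (B : set (bop L K)) T S :
  isometry A (col_space B) T -> isometry B (col_space A) S ->
  exists U, unitary (col_space A) (col_space B) U.
Proof.
move=> iT iS; apply: (orth_sum_unique (A := col_space B) (B := col_space A)).
- exact: col_space_subspace.
- exact: col_space_subspace.
- exact: orth_sum_absorb iS.
- exact/orth_sumC/(orth_sum_absorb iT).
Qed.

End ColumnStabilisation.

(** * Compact stabilisation and complete isometries *)

Section StableMatrices.
Variable R : realType.

Section Elementary.
Variables H K : hilbertType R.
Implicit Types (X : set (bop H K)) (S : bop (l2 H) (l2 K)).

Definition elem_mx i j (x : bop H K) : bop (l2 H) (l2 K) :=
  l2_inj K i \ob x \ob l2_proj H j.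

Lemma elem_mx0 i j : elem_mx i j 0 = 0.
Proof. by rewrite /elem_mx bcomp0r bcomp0l. Qed.

Lemma elem_mx_linear i j : linear (elem_mx i j).
Proof.
by move=> a x y; rewrite /elem_mx bcomp_linear (bcompr_linear (l2_proj H j)).
Qed.

(** Padding by zeros lets matrices of different sizes be added. *)
Lemma mx_op_paddable n (T : 'M[bop H K]_n) X : X 0 -> (forall i j, X (T i j)) ->
  exists t : nat -> nat -> bop H K, (forall i j, X (t i j)) /\
    forall N, (n <= N)%N ->
    mx_op T = \sum_(i < N) \sum_(j < N) elem_mx i j (t i j).
Proof.
move=> X0 XT.
pose t i j := if insub i is Some i' then
  if insub j is Some j' then T i' j' else 0 else 0.
exists t; split=> [i j|N nN].
  by rewrite /t; case: insubP => // i' _ _; case: insubP.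
have tout i j : ~~ ((i < n) && (j < n))%N -> t i j = 0.
  rewrite /t; case: insubP => // i' -> _; case: insubP => // j' -> _.
  by [].
have tT (i j : 'I_n) : t i j = T i j by rewrite /t !valK.
rewrite /mx_op.
under eq_bigr do under eq_bigr do rewrite -tT -/(elem_mx _ _ _).
rewrite (big_ord_widen _ (fun i => \sum_(j < n) elem_mx i j (t i j)) nN).
rewrite big_mkcond/=; apply: eq_bigr => i _; case: ifPn => [lti|gei].
  rewrite (big_ord_widen _ (fun j => elem_mx i j (t i j)) nN).
  rewrite big_mkcond/=; apply: eq_bigr => j _; case: ifPn => // gej.
  by rewrite tout ?elem_mx0// lti.
by rewrite big1// => j _; rewrite tout ?elem_mx0// (negPf gei).
Qed.

Lemma mx_op_subspace X : is_subspace X ->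
  is_subspace [set S | exists n (T : 'M[bop H K]_n),
    (forall i j, X (T i j)) /\ S = mx_op T].
Proof.
move=> sX; have [X0 XL] := sX; split.
  by exists 0%N, 0; split=> [[]//|]; rewrite /mx_op big_ord0.
move=> a _ _ [n [T [XT ->]]] [m [U [XU ->]]].
have [t [Xt Tt]] := mx_op_paddable X0 XT.
have [u [Xu Uu]] := mx_op_paddable X0 XU.
exists (maxn n m), (\matrix_(i, j) (a *: t i j + u i j)).
split=> [i j|]; first by rewrite mxE; exact: XL.
rewrite (Tt (maxn n m)) ?leq_maxl// (Uu (maxn n m)) ?leq_maxr//.
rewrite scaler_sumr -big_split/=; apply: eq_bigr => i _.
rewrite scaler_sumr -big_split/=; apply: eq_bigr => j _.
by rewrite mxE -/(elem_mx _ _ _) elem_mx_linear.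
Qed.

Lemma K_infty_subspace X : is_subspace X -> is_subspace (K_infty X).
Proof. by move=> sX; apply/closure_subspace/mx_op_subspace. Qed.

Lemma K_infty_closed X : closed (K_infty X).
Proof. exact: closed_closure. Qed.

Lemma K_infty_elem_mx X i j x : is_subspace X -> X x -> K_infty X (elem_mx i j x).
Proof.
move=> [X0 _] Xx; apply: subset_closure; pose N := (maxn i j).+1.
have iN : (i < N)%N by rewrite ltnS leq_maxl.
have jN : (j < N)%N by rewrite ltnS leq_maxr.
exists N, (\matrix_(k, l) if (k == Ordinal iN) && (l == Ordinal jN) then x else 0).
split=> [k l|]; first by rewrite mxE; case: ifP.
rewrite /mx_op (bigD1 (Ordinal iN))//= (bigD1 (Ordinal jN))//= mxE !eqxx/=.
rewrite !big1 ?addr0// => [k ki|l lj].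
  by rewrite big1// => l _; rewrite mxE (negPf ki) -/(elem_mx _ _ _) elem_mx0.
by rewrite mxE (negPf lj) andbF -/(elem_mx _ _ _) elem_mx0.
Qed.

(** The elementary matrices generate [K_infty]; with [K_infty_elem_mx] this reduces
   statements about [K_infty] to single entries. *)
Lemma K_infty_min X (W : set (bop (l2 H) (l2 K))) :
  is_subspace W -> closed W ->
  (forall i j x, X x -> W (elem_mx i j x)) -> K_infty X `<=` W.
Proof.
move=> sW cW XW; rewrite (closure_id W).1//; apply: closure_subset.
move=> _ [n [T [XT ->]]]; apply: subspace_sum => // i _.
by apply: subspace_sum => // j _; exact: XW.
Qed.

Lemma bcomp_map_K_infty (G : hilbertType R) X (W : set (bop (l2 H) G))
    (U : bop (l2 K) G) :
  is_subspace W -> closed W ->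
  (forall i j x, X x -> W (U \ob elem_mx i j x)) ->
  forall S, K_infty X S -> W (U \ob S).
Proof.
move=> sW cW UX; apply: (@K_infty_min X [set S | W (U \ob S)]) => //.
- split=> [|a S T WS WT]; first by rewrite /= bcomp0r; case: sW.
  by rewrite /= bcomp_linear; case: sW => _; apply.
- by apply: (closed_comp (f := fun S => U \ob S)) cW => // S _; exact: bcomp_continuous.
Qed.

End Elementary.

Section MatrixNorm.
Variables H K : hilbertType R.

Lemma nrm_sqr_l2_finite (G : hilbertType R) n (f : l2 G) :
  (forall i, (n <= i)%N -> f i = 0) -> nrm f ^+ 2 = \sum_(i < n) nrm (f i) ^+ 2.
Proof.
move=> f0; rewrite nrm_l2; apply: lim_near_cst => //.
exists n => // N /= nN; rewrite /series/= (@big_cat_nat _ _ _ n)//= big_mkord.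
rewrite [X in _ + X]big_nat [X in _ + X]big1 ?addr0// => i /andP[ni _].
by rewrite f0// nrm0 expr0n.
Qed.

Lemma mx_op_ord n (T : 'M[bop H K]_n) f (i : 'I_n) :
  mx_op T f i = \sum_(j < n) T i j (f j).
Proof. by rewrite mx_opE valK. Qed.

Lemma nrm_mx_op n (T : 'M[bop H K]_n) f : nrm (mx_op T f) =
  Num.sqrt (\sum_(i < n) nrm (\sum_(j < n) T i j (f j)) ^+ 2).
Proof.
rewrite -[LHS]ger0_norm ?nrm_ge0// -sqrtr_sqr; congr Num.sqrt.
rewrite (@nrm_sqr_l2_finite _ n) => [|i ni].
  by apply: eq_bigr => i _; rewrite mx_op_ord.
by rewrite mx_opE insubF// ltnNge ni.
Qed.

(** Identifying the matrix norm with an operator norm makes it visibly invariant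
   under adjoints. *)
Lemma mx_opnormE n (T : 'M[bop H K]_n) : mx_opnorm T = opnorm (mx_op T).
Proof.
congr sup; apply/seteqP; split=> [_ [x /= x1 <-]|_ [f /= f1 <-]].
- pose f := \sum_(j < n) l2_inj H j (x j).
  have fj (j : 'I_n) : f j = x j.
    rewrite /f l2_sumE (bigD1 j)//= eqxx big1 ?addr0// => k kj.
    by case: eqP => // jk; case/eqP: kj; exact/val_inj.
  exists f; last first.
    rewrite nrm_mx_op; congr Num.sqrt; apply: eq_bigr => i _.
    by congr (nrm _ ^+ 2); apply: eq_bigr => j _; rewrite fj.
  rewrite -ler_sqr ?nnegrE ?nrm_ge0// expr1n (@nrm_sqr_l2_finite _ n) => [|i ni].
    by rewrite (eq_bigr (fun j => nrm (x j) ^+ 2)) => [//|j _]; rewrite fj.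
  by rewrite /f l2_sumE big1// => j _ /=; rewrite gtn_eqF// (leq_trans _ ni).
- exists (fun j => f j); last by rewrite nrm_mx_op.
  apply: le_trans (_ : nrm f ^+ 2 <= 1); last by rewrite expr_le1 ?nrm_ge0.
  by rewrite -(big_mkord xpredT (fun j => nrm (f j) ^+ 2)) nrm_l2_partial.
Qed.

Definition mx_adj n (T : 'M[bop H K]_n) : 'M[bop K H]_n := \matrix_(i, j) adj (T j i).

Lemma adj_mx_op n (T : 'M[bop H K]_n) : adj (mx_op T) = mx_op (mx_adj T).
Proof.
rewrite /mx_op adj_sum; under eq_bigr do rewrite adj_sum.
rewrite exchange_big; apply: eq_bigr => i _; apply: eq_bigr => j _.
by rewrite !adj_comp adj_l2_proj adj_l2_inj mxE bcompA.
Qed.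

End MatrixNorm.

Lemma mx_opnorm_adj (H K : hilbertType R) n (T : 'M[bop H K]_n) :
  mx_opnorm (mx_adj T) = mx_opnorm T.
Proof. by rewrite !mx_opnormE -adj_mx_op opnorm_adj. Qed.

Section CompleteIsometries.

Lemma completely_isometrically_isomorphic_trans (H K H' K' H'' K'' : hilbertType R)
    (X : set (bop H K)) (Y : set (bop H' K')) (Z : set (bop H'' K'')) :
  completely_isometrically_isomorphic X Y ->
  completely_isometrically_isomorphic Y Z ->
  completely_isometrically_isomorphic X Z.
Proof.
move=> [phi [lphi bphi nphi]] [psi [lpsi bpsi npsi]].
have phiY x : X x -> Y (phi x) by have [fX _ _] := bphi; exact: fX.
exists (psi \o phi); split.
- by move=> a S T XS XT /=; rewrite lphi// lpsi//; exact: phiY.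
- exact: set_bij_comp bpsi.
- move=> n T XT; rewrite map_mx_comp npsi ?nphi// => i j.
  by rewrite mxE; exact: phiY.
Qed.

Definition adj_set (H K : hilbertType R) (X : set (bop H K)) : set (bop K H) :=
  [set T | X (adj T)].

(** If phi works for the adjoints, then S |-> adj (phi (adj S)) works: the two
   conjugate-linear steps cancel, and each of them preserves matrix norms up to
   transposition. *)
Lemma completely_isometrically_isomorphic_adj (H K H' K' : hilbertType R)
    (X : set (bop H K)) (Y : set (bop H' K')) :
  completely_isometrically_isomorphic (adj_set X) (adj_set Y) ->
  completely_isometrically_isomorphic X Y.
Proof.
move=> [phi [lphi [fphi iphi sphi] nphi]].
have XX S : X S -> adj_set X (adj S) by rewrite /adj_set/= adjK.
exists (fun S => adj (phi (adj S))); split.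
- move=> a S T XS XT; rewrite adjD adjZ lphi; [|exact: XX|exact: XX].
  by rewrite adjD adjZ conjcK.
- split=> [S XS|S T|S YS].
  + by apply: fphi; exact: XX.
  + rewrite !inE => XS XT /(congr1 (@adj _ _ _)); rewrite !adjK => ST.
    by rewrite -(adjK S) -(adjK T); congr adj; apply: iphi => //; rewrite inE; exact: XX.
  + have [|T XT TS] := sphi (adj S); first by rewrite /adj_set/= adjK.
    by exists (adj T) => //; rewrite adjK TS adjK.
- move=> n T XT; rewrite -[RHS]mx_opnorm_adj -nphi => [|i j]; last first.
    by rewrite mxE; exact: XX.
  rewrite -[RHS]mx_opnorm_adj; congr mx_opnorm.
  by apply/matrixP => i j; rewrite !mxE.
Qed.

Lemma K_infty_adj_set_sub (H K : hilbertType R) (X : set (bop H K)) :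
  K_infty (adj_set X) `<=` adj_set (K_infty X).
Proof.
move=> S /closure_nrmP cS; apply/closure_nrmP => e /cS[_ [n [T [XT ->]]] ST].
exists (adj (mx_op T)).
  exists n, (mx_adj T); split; last exact: adj_mx_op.
  by move=> i j; rewrite mxE; exact: XT.
by rewrite -adjB /nrm normr_bop opnorm_adj.
Qed.

Lemma K_infty_adj_set (H K : hilbertType R) (X : set (bop H K)) :
  K_infty (adj_set X) = adj_set (K_infty X).
Proof.
have adj_setK (G G' : hilbertType R) (Z : set (bop G G')) : adj_set (adj_set Z) = Z.
  by apply/funext => S; rewrite /adj_set/= adjK.
apply/seteqP; split; first exact: K_infty_adj_set_sub.
move=> S XS; have /K_infty_adj_set_sub : K_infty (adj_set (adj_set X)) (adj S).
  by rewrite adj_setK.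
by rewrite /adj_set/= adjK.
Qed.

Lemma stably_isomorphic_adj (H K H' K' : hilbertType R)
    (X : set (bop H K)) (Y : set (bop H' K')) :
  stably_isomorphic (adj_set X) (adj_set Y) -> stably_isomorphic X Y.
Proof.
rewrite /stably_isomorphic !K_infty_adj_set.
exact: completely_isometrically_isomorphic_adj.
Qed.

Section LeftMultiplication.
Variables (L H K : hilbertType R) (X : set (bop L H)) (Y : set (bop L K)).
Variable U : bop (l2 H) (l2 K).
Hypotheses (sX : is_subspace X) (sY : is_subspace Y).
Hypothesis uU : isometry (col_space X) (col_space Y) U.

(** An elementary matrix is a generator of the column space followed by a
   coordinate projection, and left multiplication by U ignores that projection. *)
Lemma isometry_K_infty : isometry (K_infty X) (K_infty Y) U.
Proof.
have Kmul (G : hilbertType R) (Z : set (bop L G)) j d : is_subspace Z ->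
    col_space Z d -> K_infty Z (d \ob l2_proj L j).
  move=> sZ; apply: bcompr_closed_span.
  - exact: K_infty_subspace.
  - exact: K_infty_closed.
  - by move=> _ [i [z [Zz ->]]]; exact: K_infty_elem_mx.
have [[UX UY] iU] := uU.
have sKX := K_infty_subspace sX; have cKX := @K_infty_closed _ _ X.
have sKY := K_infty_subspace sY; have cKY := @K_infty_closed _ _ Y.
split; [split|].
- apply: bcomp_map_K_infty => // i j x Xx.
  by rewrite /elem_mx bcompA; apply: Kmul => //; apply/UX/col_space_inj.
- apply: bcomp_map_K_infty => // i j x Xx.
  by rewrite /elem_mx bcompA; apply: Kmul => //; apply/UY/col_space_inj.
- move=> S XS; apply/eqP; rewrite -subr_eq0 -[X in _ - X]bcomp1l bcompA -bcompBl.
  apply/eqP; apply: (@bcomp_map_K_infty _ _ _ X [set 0]) XS => [||i j x Xx].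
  + by split=> // a x y -> ->; rewrite scaler0 addr0.
  + exact/accessible_closed_set1/hausdorff_accessible/norm_hausdorff.
  + rewrite /= bcompBl bcomp1l /elem_mx bcompA -(bcompA (adj U)).
    by rewrite iU ?subrr//; exact: col_space_inj.
Qed.

(** The vectors whose norms enter the left-hand side are U v with v a sum of
   vectors in ranges of operators from [K_infty X], and adj U \ob U fixes those. *)
Lemma isometry_mx_opnorm n (T : 'M[bop (l2 L) (l2 H)]_n) :
  (forall i j, K_infty X (T i j)) ->
  mx_opnorm (map_mx (fun S => U \ob S) T) = mx_opnorm T.
Proof.
move=> XT; congr sup; congr (_ @` _); apply/funext => x.
congr Num.sqrt; apply: eq_bigr => i _.
under eq_bigr do rewrite mxE /=.
rewrite -linear_sum; set v := \sum_(j < n) T i j (x j).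
suff -> : nrm (U v) ^+ 2 = nrm v ^+ 2 by [].
rewrite nrm_sqr_adj [RHS]nrm_sqr; congr (complex.Re (hdot _ _)).
rewrite /v linear_sum; apply: eq_bigr => j _.
by have /(congr1 (fun S : bop _ _ => S (x j))) := isometry_K_infty.2 _ (XT i j).
Qed.

End LeftMultiplication.

Lemma unitary_stably_isomorphic (L H K : hilbertType R) (X : set (bop L H))
    (Y : set (bop L K)) U : is_subspace X -> is_subspace Y ->
  unitary (col_space X) (col_space Y) U -> stably_isomorphic X Y.
Proof.
move=> sX sY [iU iU'].
have [[UX UY] UK] := isometry_K_infty sX sY iU.
have [_ UK'] := isometry_K_infty sY sX iU'.
exists (fun S => U \ob S); split.
- by move=> a S T _ _; exact: bcomp_linear.
- split=> [S /UX//|S T|S YS].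
  + rewrite !inE => XS XT /(congr1 (bcomp (adj U))).
    by rewrite !UK.
  + by exists (adj U \ob S); [exact: UY|have := UK' S YS; rewrite adjK].
- by move=> n T; exact: (isometry_mx_opnorm sX sY iU).
Qed.

End CompleteIsometries.
End StableMatrices.

(** * Stable isomorphism *)

Section OneSided.
Variable R : realType.

(** The one-sided case: n gives the isometry of A into col B, and the adjoints of
   m that of B into col A. *)
Lemma stably_isomorphic_left (L H K : hilbertType R)
    (A : set (bop L H)) (B : set (bop L K)) (m n : nat -> bop H K) :
  operator_space A -> operator_space B ->
  (forall i a, A a -> B (m i \ob a)) ->
  (forall i b, B b -> A (adj (m i) \ob b)) ->
  (forall i a, A a -> B (n i \ob a)) ->
  (forall i b, B b -> A (adj (n i) \ob b)) ->
  (forall k, `|\sum_(i < k) m i \ob adj (m i)| <= 1) ->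
  (forall k, `|\sum_(i < k) adj (n i) \ob n i| <= 1) ->
  (forall b, B b -> (\sum_(i < k) m i \ob adj (m i)) \ob b @[k --> \oo] --> b) ->
  (forall a, A a -> (\sum_(i < k) adj (n i) \ob n i) \ob a @[k --> \oo] --> a) ->
  stably_isomorphic B A.
Proof.
move=> [sA cA] [sB cB] mA mB nA nB m1 n1 mcv ncv.
have sumE k : \sum_(i < k) adj (adj (m i)) \ob adj (m i) =
    \sum_(i < k) m i \ob adj (m i) by under eq_bigr do rewrite adjK.
have am1 k : `|\sum_(i < k) adj (adj (m i)) \ob adj (m i)| <= 1 by rewrite sumE.
have iN := isometry_col_op n1 sA cA nA nB ncv.
have iM : isometry B (col_space A) (col_op (col_le1 (c := fun i => adj (m i)) am1)).
  apply: isometry_col_op => // [i a Aa|b Bb]; first by rewrite adjK; exact: mA.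
  by under eq_fun do rewrite sumE; exact: mcv.
have [U uU] := col_space_unitary iM iN.
exact: unitary_stably_isomorphic uU.
Qed.

Lemma stably_isomorphic_trans (H K H' K' H'' K'' : hilbertType R)
    (X : set (bop H K)) (Y : set (bop H' K')) (Z : set (bop H'' K'')) :
  stably_isomorphic X Y -> stably_isomorphic Y Z -> stably_isomorphic X Z.
Proof. exact: completely_isometrically_isomorphic_trans. Qed.

(** The adjoints of A and B are related by left multiplication. *)
Lemma stably_isomorphic_right (L H K : hilbertType R)
    (A : set (bop H L)) (B : set (bop K L)) (e f : nat -> bop H K) :
  operator_space A -> operator_space B ->
  (forall i a, A a -> B (a \ob adj (e i))) ->
  (forall i b, B b -> A (b \ob e i)) ->
  (forall i a, A a -> B (a \ob adj (f i))) ->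
  (forall i b, B b -> A (b \ob f i)) ->
  (forall k, `|\sum_(i < k) e i \ob adj (e i)| <= 1) ->
  (forall k, `|\sum_(i < k) adj (f i) \ob f i| <= 1) ->
  (forall b, B b -> b \ob (\sum_(i < k) e i \ob adj (e i)) @[k --> \oo] --> b) ->
  (forall a, A a -> a \ob (\sum_(i < k) adj (f i) \ob f i) @[k --> \oo] --> a) ->
  stably_isomorphic B A.
Proof.
move=> oA oB eA eB fA fB e1 f1 ecv fcv.
have adj_os (G G' : hilbertType R) (Z : set (bop G G')) :
    operator_space Z -> operator_space (adj_set Z).
  move=> [[Z0 ZL] cZ]; split; [split|].
  - by rewrite /adj_set/= adj0.
  - by move=> a x y Zx Zy; rewrite /adj_set/= adjD adjZ; exact: ZL.
  - by apply: closed_comp cZ => x _; exact: adj_continuous.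
have cvg_adj (G G' : hilbertType R) (b : bop G' G) (u : nat -> bop G G) :
    (forall k, adj (u k) = u k) ->
    adj b \ob u k @[k --> \oo] --> adj b -> u k \ob b @[k --> \oo] --> b.
  move=> au cu; have : adj (adj b \ob u k) @[k --> \oo] --> adj (adj b).
    by apply: continuous_cvg cu; exact: adj_continuous.
  by under eq_fun do rewrite adj_comp adjK au; rewrite adjK.
apply: stably_isomorphic_adj.
apply: (@stably_isomorphic_left _ _ _ _ _ e f) => //; try exact: adj_os.
- by move=> i a Aa; rewrite /adj_set/= adj_comp; exact: eA.
- by move=> i b Bb; rewrite /adj_set/= adj_comp adjK; exact: eB.
- by move=> i a Aa; rewrite /adj_set/= adj_comp; exact: fA.
- by move=> i b Bb; rewrite /adj_set/= adj_comp adjK; exact: fB.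
- move=> b Bb; apply: cvg_adj (ecv _ Bb) => k.
  by rewrite adj_sum; apply: eq_bigr => i _; rewrite adj_comp adjK.
- move=> a Aa; apply: cvg_adj (fcv _ Aa) => k.
  by rewrite adj_sum; apply: eq_bigr => i _; rewrite adj_comp adjK.
Qed.

End OneSided.

Section TernaryRings.
Variables (R : realType) (H1 H2 K1 K2 : hilbertType R).
Variables (X : set (bop K1 K2)) (Y : set (bop H1 H2)).
Variables (M1 : set (bop H1 K1)) (M2 : set (bop H2 K2)).
Hypothesis XY : strongly_tro_equivalent_by X Y M1 M2.

Let XE : X = closed_span [set T | exists a y b,
  [/\ M2 a, Y y, M1 b & T = a \ob y \ob adj b]].
Proof. by case: XY. Qed.

Let YE : Y = closed_span [set T | exists a x b,
  [/\ M2 a, X x, M1 b & T = adj a \ob x \ob b]].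
Proof. by case: XY. Qed.

Let sX : is_subspace X. Proof. by rewrite XE; exact: closed_span_subspace. Qed.
Let cX : closed X. Proof. by rewrite XE; exact: closed_span_closed. Qed.
Let sY : is_subspace Y. Proof. by rewrite YE; exact: closed_span_subspace. Qed.
Let cY : closed Y. Proof. by rewrite YE; exact: closed_span_closed. Qed.

Let M1tro a b c : M1 a -> M1 b -> M1 c -> M1 (a \ob adj b \ob c).
Proof. by case: XY => -[_ tro] *; exact: tro. Qed.

Let M2tro a b c : M2 a -> M2 b -> M2 c -> M2 (a \ob adj b \ob c).
Proof. by case: XY => _ [_ tro] *; exact: tro. Qed.

(** The ternary product keeps the leftmost (or rightmost) factor of a generator
   inside M2 (or M1). *)
Lemma left_M2M2adj_X a b x : M2 a -> M2 b -> X x -> X (a \ob adj b \ob x).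
Proof.
move=> Ma Mb; rewrite {1}XE; apply: bcomp_closed_span => //.
- move=> _ [c [y [d [Mc Yy Md ->]]]]; rewrite XE; apply: closed_span_sub.
  by exists (a \ob adj b \ob c), y, d; split; rewrite ?bcompA//; exact: M2tro.
Qed.

Lemma right_M1M1adj_X x a b : M1 a -> M1 b -> X x -> X (x \ob (a \ob adj b)).
Proof.
move=> Ma Mb; rewrite {1}XE; apply: bcompr_closed_span => //.
- move=> _ [c [y [d [Mc Yy Md ->]]]]; rewrite XE; apply: closed_span_sub.
  exists c, y, (b \ob adj a \ob d); split=> //; first exact: M1tro.
  by rewrite !adj_comp adjK !bcompA.
Qed.

Lemma right_adjM1M1_Y y a b : M1 a -> M1 b -> Y y -> Y (y \ob (adj a \ob b)).
Proof.
move=> Ma Mb; rewrite {1}YE; apply: bcompr_closed_span => //.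
- move=> _ [c [x [d [Mc Xx Md ->]]]]; rewrite YE; apply: closed_span_sub.
  exists c, x, (d \ob adj a \ob b); split=> //; first exact: M1tro.
  by rewrite !bcompA.
Qed.

(** The off-diagonal intermediate space between X and Y. *)
Definition corner : set (bop H1 K2) :=
  closed_span [set T | exists x b, [/\ X x, M1 b & T = x \ob b]].

Lemma corner_right x b : X x -> M1 b -> corner (x \ob b).
Proof. by move=> Xx Mb; apply: closed_span_sub; exists x, b. Qed.

Lemma corner_left a y : M2 a -> Y y -> corner (a \ob y).
Proof.
move=> Ma; rewrite YE; apply: bcomp_closed_span.
- exact: closed_span_subspace.
- exact: closed_span_closed.
- move=> _ [c [x [d [Mc Xx Md ->]]]].
  by rewrite !bcompA; apply: corner_right => //; exact: left_M2M2adj_X.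
Qed.

Lemma corner_adj_left a z : M2 a -> corner z -> Y (adj a \ob z).
Proof.
move=> Ma; apply: bcomp_closed_span => //.
- move=> _ [x [b [Xx Mb ->]]]; rewrite YE; apply: closed_span_sub.
  by exists a, x, b; rewrite bcompA.
Qed.

Lemma corner_adj_right z b : M1 b -> corner z -> X (z \ob adj b).
Proof.
move=> Mb; apply: bcompr_closed_span => //.
- move=> _ [x [c [Xx Mc ->]]]; rewrite -bcompA; exact: right_M1M1adj_X.
Qed.

(** This second description transfers to the corner the right approximate unit of
   Y, just as the definition transfers the left approximate unit of X. *)
Lemma corner_leftE : corner =
  closed_span [set T | exists a y, [/\ M2 a, Y y & T = a \ob y]].
Proof.
apply/seteqP; split; apply: closed_span_min;
  try exact: closed_span_subspace; try exact: closed_span_closed.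
- move=> _ [x [b [Xx Mb ->]]]; move: Xx; rewrite {1}XE.
  apply: bcompr_closed_span.
  + exact: closed_span_subspace.
  + exact: closed_span_closed.
  + move=> _ [a [y [d [Ma Yy Md ->]]]]; apply: closed_span_sub.
    exists a, (y \ob (adj d \ob b)); split=> //; first exact: right_adjM1M1_Y.
    by rewrite !bcompA.
- by move=> _ [a [y [Ma Yy ->]]]; exact: corner_left.
Qed.

End TernaryRings.

Section ApproximateUnits.
Variables (R : realType) (H K : hilbertType R).

(** Contractions are equicontinuous, so an approximate unit needs to be tested on
   generators only. *)
Lemma contraction_cvg_closed_span (f : nat -> bop H K -> bop H K) S :
  (forall k, linear (f k)) -> (forall k x, opnorm (f k x) <= opnorm x) ->
  (forall x, S x -> f k x @[k --> \oo] --> x) ->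
  forall x, closed_span S x -> f k x @[k --> \oo] --> x.
Proof.
move=> lf f1 fS.
have f0 k : f k 0 = 0 by have := lf k (-1) 0 0; rewrite !scaleN1r !addNr.
apply: (@closed_span_min _ _ S [set x | f k x @[k --> \oo] --> x]) => //.
- split=> [|a x y /= cx cy].
    by rewrite /=; under eq_fun do rewrite f0; exact: cvg_cst.
  under eq_fun do rewrite lf; apply: cvgD => //; exact: cvgZr.
- rewrite -[X in closed X]/(_ : set _) => x /closure_nrmP cx.
  apply/cvg_nrmP => e e0; have e3 : 0 < e / 3 by rewrite divr_gt0.
  have [y /cvg_nrmP cy xy] := cx _ e3; apply: filterS (cy _ e3) => k yk.
  have fB : f k (x - y) = f k x - f k y.
    by rewrite -[x - y]addrC -scaleN1r lf scaleN1r addrC.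
  have -> : x - f k x = (x - y) + (y - f k y) - f k (x - y).
    by rewrite fB opprB !subrKA.
  have fxy : nrm (f k (x - y)) <= nrm (x - y) := f1 k (x - y).
  apply: (le_lt_trans (nrmD _ _)); rewrite nrmN.
  apply: (@le_lt_trans _ _ (nrm (x - y) + nrm (y - f k y) + nrm (x - y))).
    by rewrite lerD// nrmD.
  by move: xy yk; lra.
Qed.

End ApproximateUnits.

Theorem theorem4p6 (R : realType) (H1 H2 K1 K2 : hilbertType R)
    (X : set (bop K1 K2)) (Y : set (bop H1 H2))
    (M1 : set (bop H1 K1)) (M2 : set (bop H2 K2))
    (m n : nat -> bop H2 K2) (e f : nat -> bop H1 K1) :
  operator_space X -> operator_space Y ->
  strongly_tro_equivalent_by X Y M1 M2 ->
  (forall i, M2 (m i)) -> (forall i, M2 (n i)) ->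
  (forall k, `|\sum_(i < k) m i \ob adj (m i)| <= 1) ->
  (forall k, `|\sum_(i < k) adj (n i) \ob n i| <= 1) ->
  (forall x, X x -> (\sum_(i < k) m i \ob adj (m i)) \ob x @[k --> \oo] --> x) ->
  (forall y, Y y -> (\sum_(i < k) adj (n i) \ob n i) \ob y @[k --> \oo] --> y) ->
  (forall i, M1 (e i)) -> (forall i, M1 (f i)) ->
  (forall k, `|\sum_(i < k) e i \ob adj (e i)| <= 1) ->
  (forall k, `|\sum_(i < k) adj (f i) \ob f i| <= 1) ->
  (forall x, X x -> x \ob (\sum_(i < k) e i \ob adj (e i)) @[k --> \oo] --> x) ->
  (forall y, Y y -> y \ob (\sum_(i < k) adj (f i) \ob f i) @[k --> \oo] --> y) ->
  stably_isomorphic X Y.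
Proof.
move=> oX oY XY Mm Mn m1 n1 mcv ncv Me Mf e1 f1 ecv fcv.
pose Z := corner X M1.
have oZ : operator_space Z.
  by split; [exact: closed_span_subspace|exact: closed_span_closed].
apply: (@stably_isomorphic_trans _ _ _ _ _ _ _ _ Z).
- apply: (@stably_isomorphic_right _ _ _ _ _ _ e f) => //.
  + by move=> i z; apply: (corner_adj_right XY).
  + by move=> i x Xx; apply: corner_right.
  + by move=> i z; apply: (corner_adj_right XY).
  + by move=> i x Xx; apply: corner_right.
  + move=> z; rewrite /Z (corner_leftE XY) => Zz.
    set P := fun k => \sum_(i < k) adj (f i) \ob f i.
    apply: (@contraction_cvg_closed_span _ _ _ (fun k z => z \ob P k)) Zz => /=.
    * by move=> k; exact: bcompr_linear.
    * move=> k z'; apply: le_trans (opnorm_comp _ _) _.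
      by rewrite ler_piMr ?opnorm_ge0// -lecR; exact: f1.
    * move=> _ [a [y [Ma Yy ->]]]; under eq_fun do rewrite -bcompA.
      by apply: continuous_cvg (fcv _ Yy); exact: bcomp_continuous.
- apply: (@stably_isomorphic_left _ _ _ _ _ _ m n) => //.
  + by move=> i y; apply: (corner_left XY).
  + by move=> i z; apply: (corner_adj_left XY).
  + by move=> i y; apply: (corner_left XY).
  + by move=> i z; apply: (corner_adj_left XY).
  + move=> z; set P := fun k => \sum_(i < k) m i \ob adj (m i).
    apply: (@contraction_cvg_closed_span _ _ _ (fun k z => P k \ob z)) => /=.
    * by move=> k; exact: bcomp_linear.
    * move=> k z'; apply: le_trans (opnorm_comp _ _) _.
      by rewrite ler_piMl ?opnorm_ge0// -lecR; exact: m1.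
    * move=> _ [x [b [Xx Mb ->]]]; under eq_fun do rewrite bcompA.
      apply: (@continuous_cvg _ _ _ _ _ _ (fun T => T \ob b) _ _ (mcv _ Xx)).
      exact: bcompr_continuous.
Qed.
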